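(* There is a polynomial-time $2$-approximation algorithm for the Fixed Charge Transportation problem with Uniform Fixed Costs (FCT-U): given any FCT-U instance, it outputs a feasible solution $x\in\mathcal{X}$ whose cost is at most $2$ times the optimum cost of the instance.
   Context: Fixed Charge Transportation (FCT): we are given a set $S$ of $n$ sources and a set $T$ of $m$ sinks; each source $i$ has supply $a_i\in\mathbb{Z}_{>0}$, each sink $j$ has demand $b_j\in\mathbb{Z}_{>0}$, with $\sum_{i\in S}a_i=\sum_{j\in T}b_j$; every pair $(i,j)\in S\times T$ has a fixed cost $f_{ij}\ge 0$ and a linear cost ratio $c_{ij}\ge 0$. The feasible set is $\mathcal{X}=\{x\in\mathbb{R}_{\ge0}^{S\times T}:\sum_{j\in T}x_{ij}=a_i\ \forall i\in S,\ \sum_{i\in S}x_{ij}=b_j\ \forall j\in T\}$, and the cost of $x\in\mathcal{X}$ is $\sum_{i\in S,j\in T}(\mathbf{1}_{x_{ij}>0}f_{ij}+c_{ij}x_{ij})$; the goal is to minimize the cost. FCT-U is the special case where $f_{ij}=1$ for all $i\in S,j\in T$ (the $c_{ij}$ are arbitrary nonnegative reals). *)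

(* Defs.v *)
From HB Require Import structures.
From mathcomp Require Import all_boot all_order all_algebra.
From mathcomp Require Import boolp classical_sets reals.

Set Implicit Arguments.
Unset Strict Implicit.
Unset Printing Implicit Defensive.

Import Order.TTheory GRing.Theory Num.Theory.

Local Open Scope ring_scope.

(** * Fixed Charge Transportation *)

Record fct (R : realType) := FCT {
  nsrc : nat;
  nsnk : nat;
  supply : 'I_nsrc -> nat;
  demand : 'I_nsnk -> nat;
  fixed_cost : 'I_nsrc -> 'I_nsnk -> R;
  cost_ratio : 'I_nsrc -> 'I_nsnk -> R;
  supply_gt0 : forall i, (0 < supply i)%N;
  demand_gt0 : forall j, (0 < demand j)%N;
  balanced : (\sum_i supply i = \sum_j demand j)%N;
  fixed_cost_ge0 : forall i j, 0 <= fixed_cost i j;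
  cost_ratio_ge0 : forall i j, 0 <= cost_ratio i j
}.

Definition feasible (R : realType) (I : fct R) :
    set 'M[R]_(nsrc I, nsnk I) :=
  [set x | [/\ forall i j, 0 <= x i j,
               forall i, \sum_j x i j = (supply i)%:R
             & forall j, \sum_i x i j = (demand j)%:R]]%classic.
Arguments feasible {R} I _.

Definition cost (R : realType) (I : fct R) (x : 'M[R]_(nsrc I, nsnk I)) : R :=
  \sum_i \sum_j ((if 0 < x i j then fixed_cost i j else 0)
                 + cost_ratio i j * x i j).

Definition opt_cost (R : realType) (I : fct R) : R :=
  inf [set cost x | x in feasible I]%classic.

Definition uniform_fixed_costs (R : realType) (I : fct R) : Prop :=
  forall i j, @fixed_cost R I i j = 1.

(** * Model of computation

  A real RAM, programmed in a structured language, with one memory of natural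
  numbers (used also for addresses) and one of real numbers.  Time counts the
  elementary operations executed, each at unit cost.  The operations are chosen
  so that unit cost is polynomially equivalent to bit cost:
  - naturals have no unit-cost product, so their bit length grows by O(1) per
    operation;
  - a real can be multiplied or divided by a natural but not by another real,
    and there are no real constants and no rounding.  After t steps each real
    is a rational linear combination of the real inputs and 1, whose
    coefficients have bit length polynomial in t and the input size.
  Hence real inputs are allowed, and on rational inputs a program running in
  polynomial time can be simulated by a Turing machine in polynomial time. *)

Inductive nexp :=
  | NConst of nat
  | NLoad of nexp
  | NAdd of nexp & nexp
  | NSub of nexp & nexp
  | NDiv of nexp & nexp
  | NMod of nexp & nexp.

Inductive rexp :=
  | RLoad of nexp
  | ROfNat of nexp
  | RAdd of rexp & rexp
  | RSub of rexp & rexp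
  | RMulN of rexp & nexp
  | RDivN of rexp & nexp.

Inductive bexp :=
  | BNLe of nexp & nexp
  | BRLe of rexp & rexp
  | BNot of bexp
  | BAnd of bexp & bexp.

Inductive cmd :=
  | Skip
  | NStore of nexp & nexp
  | RStore of nexp & rexp
  | Seq of cmd & cmd
  | If of bexp & cmd & cmd
  | While of bexp & cmd.

Record state (R : realType) := State { nmem : nat -> nat; rmem : nat -> R }.

Definition upd (T : Type) (f : nat -> T) (a : nat) (v : T) : nat -> T :=
  fun k => if k == a then v else f k.

Fixpoint neval (R : realType) (s : state R) (e : nexp) : nat :=
  match e with
  | NConst n => n
  | NLoad a => nmem s (neval s a)
  | NAdd e1 e2 => neval s e1 + neval s e2
  | NSub e1 e2 => neval s e1 - neval s e2
  | NDiv e1 e2 => neval s e1 %/ neval s e2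
  | NMod e1 e2 => neval s e1 %% neval s e2
  end%N.

Fixpoint reval (R : realType) (s : state R) (e : rexp) : R :=
  match e with
  | RLoad a => rmem s (neval s a)
  | ROfNat e1 => (neval s e1)%:R
  | RAdd e1 e2 => reval s e1 + reval s e2
  | RSub e1 e2 => reval s e1 - reval s e2
  | RMulN e1 e2 => reval s e1 * (neval s e2)%:R
  | RDivN e1 e2 => reval s e1 / (neval s e2)%:R
  end.

Fixpoint beval (R : realType) (s : state R) (b : bexp) : bool :=
  match b with
  | BNLe e1 e2 => (neval s e1 <= neval s e2)%N
  | BRLe e1 e2 => reval s e1 <= reval s e2
  | BNot b1 => ~~ beval s b1
  | BAnd b1 b2 => beval s b1 && beval s b2
  end.

Fixpoint ntime (e : nexp) : nat :=
  match e with
  | NConst _ => 1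
  | NLoad a => (ntime a).+1
  | NAdd e1 e2 | NSub e1 e2 | NDiv e1 e2 | NMod e1 e2 =>
      (ntime e1 + ntime e2).+1
  end%N.

Fixpoint rtime (e : rexp) : nat :=
  match e with
  | RLoad e1 | ROfNat e1 => (ntime e1).+1
  | RAdd e1 e2 | RSub e1 e2 => (rtime e1 + rtime e2).+1
  | RMulN e1 e2 | RDivN e1 e2 => (rtime e1 + ntime e2).+1
  end%N.

Fixpoint btime (b : bexp) : nat :=
  match b with
  | BNLe e1 e2 => (ntime e1 + ntime e2).+1
  | BRLe e1 e2 => (rtime e1 + rtime e2).+1
  | BNot b1 => (btime b1).+1
  | BAnd b1 b2 => (btime b1 + btime b2).+1
  end%N.

(** [exec c s s' t]: started in [s], the program [c] halts in [s'] after [t]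
  elementary operations.  This relation is functional in [(c, s)]. *)
Inductive exec (R : realType) : cmd -> state R -> state R -> nat -> Prop :=
  | ExecSkip s : exec Skip s s 1
  | ExecNStore a e s :
      exec (NStore a e) s
        (State (upd (nmem s) (neval s a) (neval s e)) (rmem s))
        (ntime a + ntime e).+1
  | ExecRStore a e s :
      exec (RStore a e) s
        (State (nmem s) (upd (rmem s) (neval s a) (reval s e)))
        (ntime a + rtime e).+1
  | ExecSeq c1 c2 s1 s2 s3 t1 t2 :
      exec c1 s1 s2 t1 -> exec c2 s2 s3 t2 ->
      exec (Seq c1 c2) s1 s3 (t1 + t2)
  | ExecIf b c1 c2 s s' t :
      exec (if beval s b then c1 else c2) s s' t ->
      exec (If b c1 c2) s s' (btime b + t).+1
  | ExecWhileFalse b c s :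
      ~~ beval s b -> exec (While b c) s s (btime b).+1
  | ExecWhileTrue b c s1 s2 s3 t1 t2 :
      beval s1 b -> exec c s1 s2 t1 -> exec (While b c) s2 s3 t2 ->
      exec (While b c) s1 s3 (btime b + t1 + t2).+1.

(** * Approximation algorithms for classes of instances *)

Definition nat_input (R : realType) (I : fct R) : seq nat :=
  [:: nsrc I, nsnk I & codom (@supply R I) ++ codom (@demand R I)].

(** Both matrices are listed in row-major order. *)
Definition real_input (R : realType) (I : fct R) : seq R :=
  [seq cost_ratio i j | i <- enum 'I_(nsrc I), j <- enum 'I_(nsnk I)]
  ++ [seq fixed_cost i j | i <- enum 'I_(nsrc I), j <- enum 'I_(nsnk I)].

Definition input_state (R : realType) (I : fct R) : state R :=
  State (nth 0%N (nat_input I)) (nth 0 (real_input I)).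

Definition bit_length (k : nat) : nat := (trunc_log 2 k).+1.

Definition input_size (R : realType) (I : fct R) : nat :=
  (size (real_input I) + \sum_(k <- nat_input I) bit_length k)%N.

(** The solution is read, in row-major order, from the first cells of the real
  memory. *)
Definition output (R : realType) (I : fct R) (s : state R) :
    'M[R]_(nsrc I, nsnk I) :=
  \matrix_(i, j) rmem s (i * nsnk I + j)%N.

Definition poly_time_approx_algorithm (R : realType) (rho : R)
    (C : fct R -> Prop) (alg : cmd) : Prop :=
  exists p : {poly nat}, forall I : fct R, C I ->
    exists (s : state R) (t : nat),
      [/\ exec alg (input_state I) s t,
          (t <= p.[input_size I])%N,
          feasible I (output I s)
        & cost (output I s) <= rho * opt_cost I].

(* Main.v *)
(** A cost-minimal transportation plan x with acyclic support uses at most n + m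
  edges, while every feasible solution uses at least max(n, m) edges and pays at
  least c.x; so x is a 2-approximation.

  To find x, supplies and demands are revealed bit by bit.  Passing to the next
  bit doubles x, which keeps complementary slackness because edges have no
  capacities, and leaves at most n (or m) units to be sent.  Each unit is sent by
  a Hungarian search from the sources with excess, which crosses tight support
  edges before it changes the potentials.  Then every new edge joins a union of
  components of the support to another component, and the support stays a
  forest.  A set of edges counts as a forest here if no nonzero function supported
  on it has zero margins: this passes to subsets, survives adding an edge across
  a cut, and bounds the number of edges by a rank argument. *)
Require Import Defs.
From mathcomp Require Import all_boot all_order all_algebra.
From mathcomp Require Import boolp classical_sets reals.
From mathcomp Require Import zify ring lra.

Set Implicit Arguments.
Unset Strict Implicit.
Unset Printing Implicit Defensive.

Import Order.TTheory GRing.Theory Num.Theory.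

Local Open Scope ring_scope.

(** * A total language with bounded loops *)

(** The truncated supplies and demands of a scale need not be balanced, so a phase ends when one
    side has nothing left, while the other may keep a remainder. Doubling then gives the exhausted
    side at most one unit per node, and at the last scale the balance of the instance makes both
    sides vanish. The forest is not the support alone but a tight set [F] that also holds the edges
    of the search tree: an augmenting path stays in [F], so the new support is again part of a
    forest. The program is written in a second language with total evaluation and loops of fixed
    length, where correctness is a statement about functions on arrays; a compilation lemma turns it
    into machine executions with a time bound. Unbounded loops occur only at top level. Flows,
    excesses and depths are naturals; the reals are costs and potentials, which are only added,
    subtracted and compared. *)

Inductive arr := AX | AEx | AMk | APa | ASc.

Definition code (k : arr) : nat :=
  match k with AX => 0 | AEx => 1 | AMk => 2 | APa => 3 | ASc => 4 end%N.

Inductive ae :=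
  | Cst of nat
  | An
  | Am
  | Anm
  | Cnt
  | Inp of ae
  | Ld of arr & ae
  | AAdd of ae & ae
  | ASub of ae & ae
  | ADiv of ae & ae
  | AMod of ae & ae.

Inductive re :=
  | Cost of ae
  | Rv of ae
  | OfN of ae
  | RPlus of re & re
  | RMinus of re & re.

Inductive be :=
  | NLe of ae & ae
  | RLe of re & re
  | Not of be
  | And of be & be.

Inductive sl :=
  | SSkip
  | SN of arr & ae & ae
  | SR of ae & re
  | SC of ae & re
  | SSeq of sl & sl
  | SIf of be & sl & sl.

Inductive bound := Nodes | Edges.

(** Loop bodies are straight-line code, so loops do not nest: one counter suffices and the running
    time is linear in the loop bounds. *)
Inductive prog :=
  | Sl of sl
  | For of bound & sl
  | PSeq of prog & prog
  | PIf of be & prog & prog.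

Record ast (R : realType) := Ast {
  nv : arr -> nat -> nat;
  cv : nat -> R;
  rv : nat -> R;
  cnt : nat
}.

Section Language.
Variables (R : realType) (n m : nat) (inp : nat -> nat).
Hypotheses (n_gt0 : (0 < n)%N) (m_gt0 : (0 < m)%N).

Implicit Types (A : ast R) (s : state R).

Definition setcnt k A := Ast (nv A) (cv A) (rv A) k.

Definition setn (k : arr) i v A : ast R :=
  Ast (fun k' => if code k' == code k then upd (nv A k') i v else nv A k')
      (cv A) (rv A) (cnt A).

(* [Inp] and [Cost] wrap their index around, so that no run-time bound has to be
   checked for the compiled access to stay inside the input. *)
Fixpoint aeval A (e : ae) : nat :=
  match e with
  | Cst k => k
  | An => n
  | Am => m
  | Anm => n * m
  | Cnt => cnt A
  | Inp e => inp (aeval A e %% (n + m))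
  | Ld k e => nv A k (aeval A e)
  | AAdd e1 e2 => aeval A e1 + aeval A e2
  | ASub e1 e2 => aeval A e1 - aeval A e2
  | ADiv e1 e2 => aeval A e1 %/ aeval A e2
  | AMod e1 e2 => aeval A e1 %% aeval A e2
  end%N.

Fixpoint areval A (r : re) : R :=
  match r with
  | Cost e => cv A (aeval A e %% (n * m))%N
  | Rv e => rv A (aeval A e)
  | OfN e => (aeval A e)%:R
  | RPlus r1 r2 => areval A r1 + areval A r2
  | RMinus r1 r2 => areval A r1 - areval A r2
  end.

Fixpoint abeval A (b : be) : bool :=
  match b with
  | NLe e1 e2 => (aeval A e1 <= aeval A e2)%N
  | RLe e1 e2 => areval A e1 <= areval A e2
  | Not b => ~~ abeval A b
  | And b1 b2 => abeval A b1 && abeval A b2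
  end.

Fixpoint srun (c : sl) A : ast R :=
  match c with
  | SSkip => A
  | SN k e v => setn k (aeval A e) (aeval A v) A
  | SR e r => Ast (nv A) (cv A) (upd (rv A) (aeval A e) (areval A r)) (cnt A)
  | SC e r =>
      Ast (nv A) (upd (cv A) (aeval A e %% (n * m))%N (areval A r))
          (rv A) (cnt A)
  | SSeq c1 c2 => srun c2 (srun c1 A)
  | SIf b c1 c2 => if abeval A b then srun c1 A else srun c2 A
  end.

Definition bval (b : bound) : nat :=
  match b with Nodes => n + m | Edges => n * m end%N.

Definition forstep (c : sl) A := setcnt (cnt A).+1 (srun c A).

Fixpoint prun (p : prog) A : ast R :=
  match p with
  | Sl c => srun c A
  | For b c => iter (bval b) (forstep c) (setcnt 0 A)
  | PSeq p1 p2 => prun p2 (prun p1 A)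
  | PIf b p1 p2 => if abeval A b then prun p1 A else prun p2 A
  end.

Lemma srun_cnt c A : cnt (srun c A) = cnt A.
Proof.
elim: c A => //= [c1 IH1 c2 IH2|b c1 IH1 c2 IH2] A; first by rewrite IH2 IH1.
by case: ifP.
Qed.

Lemma for_ind (Inv : nat -> ast R -> Prop) b c A :
  Inv 0%N (setcnt 0 A) ->
  (forall k A', (k < bval b)%N -> cnt A' = k -> Inv k A' ->
     Inv k.+1 (setcnt k.+1 (srun c A'))) ->
  Inv (bval b) (prun (For b c) A).
Proof.
move=> I0 IS /=.
suff H k : (k <= bval b)%N ->
    Inv k (iter k (forstep c) (setcnt 0 A)) /\
    cnt (iter k (forstep c) (setcnt 0 A)) = k by case: (H _ (leqnn _)).
elim: k => [|k IH] // lk.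
have [Ik ck] := IH (ltnW lk).
by rewrite iterS {1}/forstep ck; split; [exact: IS | rewrite /= ck].
Qed.

(* With N = n + m.  Nat memory: the input (cells 0 to N+1), n*m in cell N+2, the loop counter in
   cell N+3, then the five arrays, interleaved.  Real memory: the costs in the
   first n*m cells and [rv] from cell 2*n*m on. *)
Definition cN := NAdd (NLoad (NConst 0)) (NLoad (NConst 1)).
Definition cMadr := NAdd cN (NConst 2).
Definition cM := NLoad cMadr.
Definition cCadr := NAdd cN (NConst 3).
(** The stride 5 is written as a sum because naturals have no product. Interleaving makes every
    array infinite, so accesses need no bound. *)
Definition cadr (k : arr) (x : nexp) :=
  NAdd (NAdd cN (NConst (4 + code k)))
       (NAdd x (NAdd x (NAdd x (NAdd x x)))).

Fixpoint ca (e : ae) : nexp :=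
  match e with
  | Cst k => NConst k
  | An => NLoad (NConst 0)
  | Am => NLoad (NConst 1)
  | Anm => cM
  | Cnt => NLoad cCadr
  | Inp e => NLoad (NAdd (NConst 2) (NMod (ca e) cN))
  | Ld k e => NLoad (cadr k (ca e))
  | AAdd e1 e2 => NAdd (ca e1) (ca e2)
  | ASub e1 e2 => NSub (ca e1) (ca e2)
  | ADiv e1 e2 => NDiv (ca e1) (ca e2)
  | AMod e1 e2 => NMod (ca e1) (ca e2)
  end.

(** The cells from n * m to 2 * n * m hold the fixed costs, so [rv] starts after them, in cells that
    are initially 0. *)
Definition crvadr (x : nexp) := NAdd (NAdd cM cM) x.

Fixpoint cr (r : re) : rexp :=
  match r with
  | Cost e => RLoad (NMod (ca e) cM)
  | Rv e => RLoad (crvadr (ca e))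
  | OfN e => ROfNat (ca e)
  | RPlus r1 r2 => RAdd (cr r1) (cr r2)
  | RMinus r1 r2 => RSub (cr r1) (cr r2)
  end.

Fixpoint cb (b : be) : bexp :=
  match b with
  | NLe e1 e2 => BNLe (ca e1) (ca e2)
  | RLe e1 e2 => BRLe (cr e1) (cr e2)
  | Not b => BNot (cb b)
  | And b1 b2 => BAnd (cb b1) (cb b2)
  end.

Fixpoint cs (c : sl) : cmd :=
  match c with
  | SSkip => Skip
  | SN k e v => NStore (cadr k (ca e)) (ca v)
  | SR e r => RStore (crvadr (ca e)) (cr r)
  | SC e r => RStore (NMod (ca e) cM) (cr r)
  | SSeq c1 c2 => Seq (cs c1) (cs c2)
  | SIf b c1 c2 => If (cb b) (cs c1) (cs c2)
  end.

Definition cbound b := match b with Nodes => cN | Edges => cM end.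
Definition cincr := NStore cCadr (NAdd (NLoad cCadr) (NConst 1)).
Definition cguard b := BNLe (NAdd (NLoad cCadr) (NConst 1)) (cbound b).

Fixpoint cp (p : prog) : cmd :=
  match p with
  | Sl c => cs c
  | For b c =>
      Seq (NStore cCadr (NConst 0)) (While (cguard b) (Seq (cs c) cincr))
  | PSeq p1 p2 => Seq (cp p1) (cp p2)
  | PIf b p1 p2 => If (cb b) (cp p1) (cp p2)
  end.

Fixpoint stime (c : sl) : nat :=
  match c with
  | SSkip => 1
  | SN k e v => (ntime (cadr k (ca e)) + ntime (ca v)).+1
  | SR e r => (ntime (crvadr (ca e)) + rtime (cr r)).+1
  | SC e r => (ntime (NMod (ca e) cM) + rtime (cr r)).+1
  | SSeq c1 c2 => stime c1 + stime c2
  | SIf b c1 c2 => (btime (cb b) + maxn (stime c1) (stime c2)).+1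
  end%N.

Definition tincr := (ntime cCadr + ntime (NAdd (NLoad cCadr) (NConst 1))).+1.
Definition tstep b c := (btime (cguard b) + (stime c + tincr)).+1.

(** An instance-independent factor: the running time is at most this constant times any L above both
    loop bounds. *)
Fixpoint pconst (p : prog) : nat :=
  match p with
  | Sl c => stime c
  | For b c => (ntime cCadr).+2 + tstep b c
  | PSeq p1 p2 => pconst p1 + pconst p2
  | PIf b p1 p2 => (btime (cb b) + maxn (pconst p1) (pconst p2)).+1
  end%N.

Definition represents A s : Prop :=
  [/\ [/\ nmem s 0 = n, nmem s 1 = m,
        forall v, (v < n + m)%N -> nmem s (2 + v) = inp v,
        nmem s (n + m + 2) = (n * m)%N & nmem s (n + m + 3) = cnt A],
      forall k i, nmem s (n + m + (4 + code k) + 5 * i) = nv A k i,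
      forall e, (e < n * m)%N -> rmem s e = cv A e
    & forall i, rmem s (n * m + n * m + i)%N = rv A i]%N.

Lemma neval_add s e1 e2 :
  neval s (NAdd e1 e2) = (neval s e1 + neval s e2)%N.
Proof. by []. Qed.

Lemma neval_mod s e1 e2 :
  neval s (NMod e1 e2) = (neval s e1 %% neval s e2)%N.
Proof. by []. Qed.

Lemma neval_load s e : neval s (NLoad e) = nmem s (neval s e).
Proof. by []. Qed.

Lemma reval_load s e : reval s (RLoad e) = rmem s (neval s e).
Proof. by []. Qed.

Lemma nevalN A s : represents A s -> neval s cN = (n + m)%N.
Proof. by case=> [[/= -> ->]]. Qed.

Lemma nevalM A s : represents A s -> neval s cM = (n * m)%N.
Proof. by case=> [[/= -> -> _ -> _]]. Qed.

Lemma neval_adr A s k x : represents A s ->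
  neval s (cadr k x) = (n + m + (4 + code k) + 5 * neval s x)%N.
Proof. by move=> /nevalN rN; rewrite /cadr 2!neval_add rN /=; lia. Qed.

Lemma neval_ca A s e : represents A s -> neval s (ca e) = aeval A e.
Proof.
move=> r; elim: e => //.
- by case: r => [[]].
- by case: r => [[]].
- exact: nevalM r.
- by case: r => [[/= -> -> _ _ ->]].
- move=> e IH; rewrite [ca _]/= neval_load neval_add neval_mod IH (nevalN r) /=.
  case: (r) => [[_ _ Hi _ _] _ _ _].
  by rewrite Hi // ltn_mod addn_gt0 n_gt0.
- move=> k e IH; rewrite [ca _]/= neval_load (neval_adr _ _ r) IH.
  by case: r => _ ->.
- by move=> e1 /= -> e2 ->.
- by move=> e1 /= -> e2 ->.
- by move=> e1 /= -> e2 ->.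
- by move=> e1 /= -> e2 ->.
Qed.

Lemma reval_cr A s r : represents A s -> reval s (cr r) = areval A r.
Proof.
move=> rp; elim: r => //.
- move=> e; rewrite [cr _]/= reval_load neval_mod (nevalM rp) (neval_ca _ rp).
  case: rp => _ _ Hc _.
  by rewrite Hc // ltn_mod muln_gt0 n_gt0.
- move=> e; rewrite [cr _]/= reval_load 2!neval_add (nevalM rp) (neval_ca _ rp).
  by case: rp => _ _ _ ->.
- by move=> e; rewrite /= (neval_ca _ rp).
- by move=> e1 /= -> e2 ->.
- by move=> e1 /= -> e2 ->.
Qed.

Lemma beval_cb A s b : represents A s -> beval s (cb b) = abeval A b.
Proof.
move=> rp; elim: b => //=.
- by move=> e1 e2; rewrite !(neval_ca _ rp).
- by move=> e1 e2; rewrite !(reval_cr _ rp).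
- by move=> b ->.
- by move=> b1 -> b2 ->.
Qed.

(** * Running times of compiled programs *)

Definition runs c s T (Q : state R -> Prop) : Prop :=
  exists s' t, [/\ exec c s s' t, (t <= T)%N & Q s'].

Lemma runs_seq c1 c2 s T1 T2 (Q1 Q2 : state R -> Prop) :
  runs c1 s T1 Q1 -> (forall s', Q1 s' -> runs c2 s' T2 Q2) ->
  runs (Seq c1 c2) s (T1 + T2) Q2.
Proof.
move=> [s1 [t1 [e1 l1 q1]]] /(_ _ q1) [s2 [t2 [e2 l2 q2]]].
by exists s2, (t1 + t2)%N; split=> //; [exact: ExecSeq e2 | exact: leq_add].
Qed.

Lemma runs_if b c1 c2 s T1 T2 (Q : state R -> Prop) :
  (if beval s b then runs c1 s T1 Q else runs c2 s T2 Q) ->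
  runs (If b c1 c2) s (btime b + maxn T1 T2).+1 Q.
Proof.
move=> H.
have [s' [t [e lt q]]] :
    runs (if beval s b then c1 else c2) s (maxn T1 T2) Q.
  by case: ifP H => _ [s' [t [e lt q]]]; exists s', t; split=> //;
    rewrite (leq_trans lt) // ?leq_maxl ?leq_maxr.
by exists s', (btime b + t).+1; split=> //; [exact: ExecIf | rewrite ltnS leq_add2l].
Qed.

(* The index of the invariant bounds the number of remaining iterations. *)
Lemma runs_while b c s T k (Inv : nat -> state R -> Prop) :
  (forall k1 s1, Inv k1 s1 -> beval s1 b ->
     runs c s1 T (fun s2 => exists2 k2, (k2 < k1)%N & Inv k2 s2)) ->
  Inv k s ->
  runs (While b c) s (k.+1 * (btime b + T).+1)
    (fun s' => exists2 k', Inv k' s' & ~~ beval s' b).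
Proof.
move=> step; elim/ltn_ind: k s => k IH s Is.
case bs: (beval s b); last first.
  exists s, (btime b).+1; split; last by exists k; rewrite ?bs.
    by apply: ExecWhileFalse; rewrite bs.
  by rewrite mulSn (leq_trans _ (leq_addr _ _)) // ltnS leq_addr.
have [s2 [t [e lt [k2 l2 I2]]]] := step _ _ Is bs.
have [s3 [t3 [e3 lt3 q3]]] := IH _ l2 _ I2.
exists s3, (btime b + t + t3).+1; split=> //; first exact: ExecWhileTrue e3.
have l1 : (btime b + t < (btime b + T).+1)%N by rewrite ltnS leq_add2l.
have l4 : (t3 <= k * (btime b + T).+1)%N.
  by rewrite (leq_trans lt3) // leq_mul2r l2 orbT.
by rewrite mulSn -addSn leq_add.
Qed.

Lemma represents_setn A s k i v : represents A s ->
  represents (setn k i v A)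
    (State (upd (nmem s) (n + m + (4 + code k) + 5 * i)%N v) (rmem s)).
Proof.
case=> [[h0 h1 hi hM hc] hk hr hv]; split=> //=.
  split; rewrite /upd //=.
  - by case: eqP => //; lia.
  - by case: eqP => //; lia.
  - by move=> w lw; case: eqP => [|_]; [lia | exact: hi].
  - by case: eqP => //; lia.
  - by case: eqP => //; lia.
move=> k' i'; rewrite /upd /=.
have cl k0 : (code k0 < 5)%N by case: k0.
case: (code k' =P code k) => [ck|ck].
  rewrite ck eqn_add2l eqn_pmul2l //; case: eqP => // _.
  by rewrite -ck hk.
by case: eqP => [|_]; [have := cl k; have := cl k'; lia | exact: hk].
Qed.

Lemma represents_setcnt A s v : represents A s ->
  represents (setcnt v A) (State (upd (nmem s) (n + m + 3)%N v) (rmem s)).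
Proof.
case=> [[h0 h1 hi hM hc] hk hr hv]; split=> //=.
  split; rewrite /upd //=.
  - by case: eqP => //; lia.
  - by case: eqP => //; lia.
  - by move=> w lw; case: eqP => [|_]; [lia | exact: hi].
  - by case: eqP => //; lia.
  - by rewrite eqxx.
by move=> k' i'; rewrite /upd; case: eqP => [|_]; [lia | exact: hk].
Qed.

Lemma runs_cs c A s : represents A s ->
  runs (cs c) s (stime c) (represents (srun c A)).
Proof.
elim: c A s => [|k e v|e r|e r|c1 IH1 c2 IH2|b c1 IH1 c2 IH2] A s rp /=.
- by exists s, 1%N; split=> //; apply: ExecSkip.
- eexists _, _; split; [exact: ExecNStore | exact: leqnn |].
  by rewrite (neval_adr _ _ rp) !(neval_ca _ rp); apply: represents_setn.
- eexists _, _; split; [exact: ExecRStore | exact: leqnn |].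
  rewrite (reval_cr _ rp) 2!neval_add (nevalM rp) (neval_ca _ rp).
  case: rp => [hh hk hr hv]; split=> //= i; rewrite /upd.
    by move=> li; case: eqP => [|_]; [lia | exact: hr].
  by rewrite eqn_add2l hv.
- eexists _, _; split; [exact: ExecRStore | exact: leqnn |].
  rewrite (reval_cr _ rp) neval_mod (nevalM rp) (neval_ca _ rp).
  have lM : (aeval A e %% (n * m) < n * m)%N by rewrite ltn_mod muln_gt0 n_gt0.
  case: rp => [hh hk hr hv]; split=> //= i; rewrite /upd.
    by move=> li; rewrite hr.
  by case: eqP => [|_]; [lia | rewrite hv].
- apply: runs_seq; first exact: IH1 rp.
  by move=> s' rp'; apply: IH2.
- apply: runs_if; rewrite (beval_cb _ rp).
  by case: (abeval A b); [exact: IH1 | exact: IH2].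
Qed.

Lemma runs_cp p A s L : represents A s -> (n + m < L)%N -> (n * m < L)%N ->
  runs (cp p) s (pconst p * L) (represents (prun p A)).
Proof.
move=> rp lN lM; have L0 : (0 < L)%N by exact: leq_ltn_trans lM.
elim: p A s rp => [c|b c|p1 IH1 p2 IH2|b p1 IH1 p2 IH2] A s rp.
- have [s' [t [e lt q]]] := runs_cs c rp.
  by exists s', t; split=> //; rewrite (leq_trans lt) // leq_pmulr.
- rewrite /pconst mulnDl.
  apply: (@runs_seq _ _ _ _ _ (represents (setcnt 0 A))).
    eexists _, _; split; [exact: ExecNStore | | ].
      by rewrite /= addn1 leq_pmulr.
    suff -> : neval s cCadr = (n + m + 3)%N by apply: represents_setcnt.
    by rewrite neval_add (nevalN rp).
  move=> s0 r0.
  have bL : (bval b < L)%N by case: b.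
  pose Inv j s1 := exists2 k, (k + j)%N = bval b
    & represents (iter k (forstep c) (setcnt 0 A)) s1.
  have Cadr A1 s1 : represents A1 s1 -> neval s1 cCadr = (n + m + 3)%N.
    by move=> r1; rewrite neval_add (nevalN r1).
  have cntk k : cnt (iter k (forstep c) (setcnt 0 A)) = k.
    by elim: k => //= k ->.
  have cntv A1 s1 : represents A1 s1 -> nmem s1 (n + m + 3) = cnt A1 by case=> [[]].
  have bnd A1 s1 : represents A1 s1 -> neval s1 (cbound b) = bval b.
    by case: (b) => r1; [exact: nevalN r1 | exact: nevalM r1].
  have guard k s1 : represents (iter k (forstep c) (setcnt 0 A)) s1 ->
      beval s1 (cguard b) = (k < bval b)%N.
    move=> r1; rewrite -[LHS]/(neval _ _ <= neval _ _)%N.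
    rewrite neval_add neval_load (bnd _ _ r1).
    by rewrite (Cadr _ _ r1) (cntv _ _ r1) cntk addn1.
  have [||s' [t [e lt [j [k lk rk] q]]]] := @runs_while (cguard b)
    (Seq (cs c) cincr) s0 (stime c + tincr) (bval b) Inv.
  + move=> j s1 [k lk r1]; rewrite (guard _ _ r1) => ltk.
    apply: runs_seq; first exact: runs_cs r1.
    move=> s2 r2.
    have c2 : nmem s2 (n + m + 3) = k by rewrite (cntv _ _ r2) srun_cnt cntk.
    eexists _, _; split; [exact: ExecNStore | exact: leqnn |].
    have -> : neval s2 (NAdd (NLoad cCadr) (NConst 1)) = k.+1.
      by rewrite neval_add neval_load (Cadr _ _ r2) c2 addn1.
    rewrite (Cadr _ _ r2); exists j.-1; first by lia.
    exists k.+1; first by lia.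
    by rewrite iterS {1}/forstep cntk; apply: represents_setcnt.
  + by exists 0%N.
  (* The guard is evaluated once more than the body; the strict inequality [bval b < L] absorbs
     this. *)
  exists s', t; split=> //; first by rewrite (leq_trans lt) // mulnC leq_mul.
  rewrite (guard _ _ rk) -leqNgt in q.
  have Ek : bval b = k by lia.
  by rewrite -[prun _ _]/(iter (bval b) (forstep c) (setcnt 0 A)) Ek.
- rewrite -[pconst _]/(pconst p1 + pconst p2)%N mulnDl.
  apply: (runs_seq (IH1 _ _ rp)).
  by move=> s' rp'; apply: IH2.
- have [|s' [t [e lt q]]] := @runs_if (cb b) (cp p1) (cp p2) s
    (pconst p1 * L) (pconst p2 * L) (represents (prun (PIf b p1 p2) A)).
    by rewrite (beval_cb _ rp) /=; case: (abeval A b); [exact: IH1 | exact: IH2].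
  exists s', t; split=> //; rewrite (leq_trans lt) //.
  rewrite -[pconst (PIf _ _ _)]/(btime (cb b) + maxn (pconst p1) (pconst p2)).+1.
  rewrite -maxnMl -!addSn mulnDl leq_add2r.
  exact: leq_pmulr.
Qed.

Lemma runs_cwhile b p A s L (Inv : ast R -> Prop) (mu : ast R -> nat) :
  (n + m < L)%N -> (n * m < L)%N ->
  (forall A1, Inv A1 -> abeval A1 b ->
     Inv (prun p A1) /\ (mu (prun p A1) < mu A1)%N) ->
  Inv A -> represents A s ->
  runs (While (cb b) (cp p)) s ((mu A).+1 * (btime (cb b) + pconst p * L).+1)
    (fun s' => exists A', [/\ represents A' s', Inv A' & ~~ abeval A' b]).
Proof.
move=> lN lM step IA rA.
have [||s' [t [e lt [k [A' [rA' IA' _]] q]]]] := @runs_while (cb b) (cp p) s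
    (pconst p * L) (mu A)
    (fun k s1 => exists A1, [/\ represents A1 s1, Inv A1 & mu A1 = k]).
- move=> k s1 [A1 [r1 I1 <-]]; rewrite (beval_cb _ r1) => b1.
  have [s2 [t [e lt r2]]] := runs_cp p r1 lN lM.
  have [I2 l2] := step _ I1 b1.
  exists s2, t; split=> //; exists (mu (prun p A1)) => //.
  by exists (prun p A1).
- by exists A.
exists s', t; split=> //; exists A'; split=> //.
by rewrite -(beval_cb _ rA').
Qed.

End Language.

(** * Flows and forests *)

(* Source [i] is node [i], sink [j] is node [n + j], and the edge from [i] to [j]
   is [i * m + j]. *)
Section Flow.
Variables (R : realType) (n m : nat).

Definition src (e : nat) : nat := (e %/ m)%N.
Definition snk (e : nat) : nat := (n + e %% m)%N.
Definition inc (e v : nat) : bool := (src e == v) || (snk e == v).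

Definition flow (x : nat -> nat) (v : nat) : nat :=
  (\sum_(e < n * m | inc e v) x e)%N.
Definition rflow (z : nat -> R) (v : nat) : R := \sum_(e < n * m | inc e v) z e.

(** Unsigned margins suffice because the graph is bipartite: a change of sign at the sinks turns
    them into divergences, and a cycle would carry an alternating nonzero solution. *)
Definition forest (F : nat -> bool) : Prop :=
  forall z : nat -> R,
    (forall e, (e < n * m)%N -> ~~ F e -> z e = 0) ->
    (forall v, (v < n + m)%N -> rflow z v = 0) ->
    forall e, (e < n * m)%N -> z e = 0.

Lemma src_lt e : (e < n * m)%N -> (src e < n)%N.
Proof. by move=> le; rewrite /src ltn_divLR; lia. Qed.

Lemma snk_lt e : (e < n * m)%N -> (snk e < n + m)%N.
Proof. by move=> le; rewrite /snk ltn_add2l ltn_mod; lia. Qed.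

Lemma snk_ge e : (n <= snk e)%N.
Proof. exact: leq_addr. Qed.

Lemma srcE i j : (j < m)%N -> src (i * m + j) = i.
Proof.
move=> lj; rewrite /src divnMDl ?divn_small ?addn0 //.
exact: leq_ltn_trans lj.
Qed.

Lemma snkE i j : (j < m)%N -> snk (i * m + j) = (n + j)%N.
Proof. by move=> lj; rewrite /snk modnMDl modn_small. Qed.

Lemma edge_lt i j : (i < n)%N -> (j < m)%N -> (i * m + j < n * m)%N.
Proof. nia. Qed.

Lemma inc_src e : inc e (src e). Proof. by rewrite /inc eqxx. Qed.
Lemma inc_snk e : inc e (snk e). Proof. by rewrite /inc eqxx orbT. Qed.

Lemma sum_edges (V : Type) (idx : V) (op : Monoid.law idx) (f : nat -> V) :
  \big[op/idx]_(e < n * m) f e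
  = \big[op/idx]_(i < n) \big[op/idx]_(j < m) f (i * m + j)%N.
Proof.
rewrite -(big_mkord xpredT f) big_nat_mul big_mkord.
apply: eq_bigr => i _; rewrite mulSn addnC -{1}[(i * m)%N]add0n.
by rewrite big_addn addKn big_mkord; apply: eq_bigr => j _; rewrite addnC.
Qed.

(** Double counting of incidences. Weights that are potentials give linear programming duality,
    signed indicators give cut arguments, and signs alone give the handshake identity. *)
Lemma rflow_weight (w z : nat -> R) :
  \sum_(v < n + m) w v * rflow z v
  = \sum_(e < n * m) z e * (w (src e) + w (snk e)).
Proof.
under eq_bigr do rewrite /rflow mulr_sumr big_mkcond.
rewrite exchange_big /=; apply: eq_bigr => e _.
have lsrc : (src e < n + m)%N by rewrite ltn_addr // src_lt.
have lsnk : (snk e < n + m)%N by rewrite snk_lt.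
rewrite (bigD1 (Ordinal lsrc)) //= inc_src (bigD1 (Ordinal lsnk)) /=; last first.
  by apply/eqP=> -[]; have := src_lt (ltn_ord e); have := snk_ge e; lia.
rewrite inc_snk big1 ?addr0; first by ring.
move=> v /andP[v1 v2]; case: ifP => // /orP[] /eqP E.
  by case/eqP: v1; apply/val_inj; rewrite /= E.
by case/eqP: v2; apply/val_inj; rewrite /= E.
Qed.

Lemma forest_sub (F G : nat -> bool) :
  (forall e, (e < n * m)%N -> G e -> F e) -> forest F -> forest G.
Proof.
move=> GF fF z zG zf; apply: fF => // e le nF; apply: zG => //.
by apply: contraNN nF; apply: GF.
Qed.

(* Summing the margins of [z] over [S], with signs, leaves only the edge [e0],
   which is the only one across the cut. *)
Lemma forest_add (F : nat -> bool) (S : nat -> bool) e0 :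
  (e0 < n * m)%N -> S (src e0) -> ~~ S (snk e0) ->
  (forall e, (e < n * m)%N -> F e -> S (src e) = S (snk e)) ->
  forest F -> forest (fun e => F e || (e == e0)).
Proof.
move=> le0 S1 S2 SF fF z zF zf.
suff z0 : z e0 = 0.
  apply: fF => // e le nF; case: (e =P e0) => [->//|/eqP ne].
  by apply: zF => //; rewrite negb_or nF.
pose w v : R := if (v < n)%N then (S v)%:R else - (S v)%:R.
have : \sum_(v < n + m) w v * rflow z v = 0.
  by rewrite big1 // => v _; rewrite zf // mulr0.
rewrite rflow_weight (bigD1 (Ordinal le0)) //= big1 ?addr0; last first.
  move=> e ne; have lsrc := src_lt (ltn_ord e); have := snk_ge e.
  rewrite /w lsrc leqNgt => /negbTE ->.
  case Fe : (F e); first by rewrite (SF e) // subrr mulr0.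
  by rewrite zF ?mul0r // Fe /=; apply: contraNneq ne => E; apply/eqP/val_inj.
rewrite /w (src_lt le0) ltnNge snk_ge S1 (negbTE S2) /= mulr1n oppr0 addr0.
by rewrite mulr1.
Qed.

(** The forest condition says that the incidence vectors of the edges in [F] are linearly
    independent in a space of dimension n + m. *)
Lemma forest_card (F : nat -> bool) : forest F ->
  (#|[pred e : 'I_(n * m) | F e]| <= n + m)%N.
Proof.
move=> fF; set E := [pred e : 'I_(n * m) | F e].
pose A : 'M[R]_(#|E|, n + m) := \matrix_(k, v) (inc (val (enum_val k)) v)%:R.
suff /eqP <- : row_free A by exact: rank_leq_col.
apply: inj_row_free => u uA.
(* The row vector [u] extended by zero to all edges; the sum has at most one term. *)
pose z e : R := \sum_(k < #|E| | val (enum_val k) == e :> nat) u 0 k.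
have zE k : z (val (enum_val k)) = u 0 k.
  rewrite /z (big_pred1 k) // => k' /=; apply/eqP/eqP => [/val_inj|->//].
  exact: enum_val_inj.
apply/rowP => k; rewrite mxE -zE.
apply: fF => [e le nF|v lv|]; last exact: ltn_ord.
  rewrite /z big1 // => k' /eqP E'; case/negP: nF.
  by rewrite -E'; have := enum_valP k'.
have /rowP/(_ (Ordinal lv)) := uA; rewrite !mxE => <-.
rewrite /rflow /z (exchange_big_dep xpredT) //=.
apply: eq_bigr => k' _; rewrite mxE /=; case: (boolP (inc _ _)) => I1.
  rewrite mulr1 (big_pred1 (enum_val k')) // => e /=.
  apply/andP/eqP => [[_ /eqP/val_inj->]//|->]; by rewrite I1 eqxx.
rewrite mulr0 big_pred0 // => e; apply/negP => /andP[I2 /eqP E'].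
by move: I1; rewrite E' I2.
Qed.

(** The old and the new value stand on opposite sides, so no truncated subtraction occurs whether
    the edge gains or loses flow. *)
Lemma flow_upd x e y v : (e < n * m)%N ->
  (flow (upd x e y) v + inc e v * x e = flow x v + inc e v * y)%N.
Proof.
move=> le; rewrite /flow; case: (boolP (inc e v)) => I1; last first.
  rewrite !mul0n !addn0; apply: eq_bigr => e' I2; rewrite /upd; case: eqP => // E'.
  by rewrite -E' I2 in I1.
rewrite !mul1n (bigD1 (Ordinal le)) //= [in RHS](bigD1 (Ordinal le)) //=.
rewrite {1}/upd eqxx addnC addnA [RHS]addnAC; congr addn.
apply: eq_bigr => e' /andP[_ ne]; rewrite /upd; case: eqP => // E'.
by case/eqP: ne; apply/val_inj.
Qed.

Lemma flow_eq x y v : (forall e, (e < n * m)%N -> x e = y e) ->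
  flow x v = flow y v.
Proof. by move=> xy; apply: eq_bigr => e _; rewrite xy. Qed.

Lemma rflow_nat x v : rflow (fun e => (x e)%:R) v = (flow x v)%:R.
Proof. by rewrite /flow natr_sum. Qed.

Lemma rflow_src (z : nat -> R) i : (i < n)%N ->
  rflow z i = \sum_(j < m) z (i * m + j)%N.
Proof.
move=> li; rewrite /rflow big_mkcond.
rewrite (sum_edges _ (fun e => if inc e i then z e else 0)).
rewrite (bigD1 (Ordinal li)) //= [X in _ + X]big1 ?addr0.
  by apply: eq_bigr => j _; rewrite /inc srcE // eqxx.
move=> i' ne; apply: big1 => j _; rewrite /inc srcE // snkE //.
case: ifP => // /orP[] /eqP E; last by lia.
by case/eqP: ne; apply/val_inj.
Qed.

Lemma rflow_snk (z : nat -> R) j : (j < m)%N ->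
  rflow z (n + j)%N = \sum_(i < n) z (i * m + j)%N.
Proof.
move=> lj; rewrite /rflow big_mkcond.
rewrite (sum_edges _ (fun e => if inc e (n + j) then z e else 0)).
apply: eq_bigr => i _; rewrite (bigD1 (Ordinal lj)) //= big1 ?addr0.
  by rewrite /inc srcE // snkE // eqxx orbT.
move=> j' ne; rewrite /inc srcE // snkE //.
case: ifP => // /orP[] /eqP E; first by have := ltn_ord i; lia.
by case/eqP: ne; apply/val_inj => /=; lia.
Qed.

End Flow.

(** * The Hungarian search *)

Section Search.
Variables (R : realType) (n m : nat) (c : nat -> R).

Local Notation src := (src m).
Local Notation snk := (snk n m).
Local Notation flow := (flow n m).
Local Notation forest := (@forest R n m).

Implicit Types (d x ex mk pa : nat -> nat) (pot : nat -> R) (F : nat -> bool).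

(** A partial plan with a dual certificate; [ex] is what is still missing at a node. [F] may exceed
    the support by tight edges, on which flow can be raised without leaving the forest. *)
Record optimal d x ex pot F : Prop := Optimal {
  opt_bal : forall v, (v < n + m)%N -> (flow x v + ex v)%N = d v;
  opt_le : forall e, (e < n * m)%N -> pot (src e) + pot (snk e) <= c e;
  opt_eq : forall e, (e < n * m)%N -> F e -> pot (src e) + pot (snk e) = c e;
  opt_supp : forall e, (e < n * m)%N -> (0 < x e)%N -> F e;
  opt_forest : forest F
}.

Definition unmarked mk : nat := (\sum_(v < n + m) (mk v == 0))%N.

(** Residual reachability: a sink is reached along an edge whose flow can grow, a source only along
    an edge whose flow can shrink. Decreasing depth rules out cycles of parents. *)
Definition parent x mk pa F v : Prop :=
  [/\ (pa v < n * m)%N, F (pa v) &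
    if (v < n)%N
    then [/\ src (pa v) = v, (0 < x (pa v))%N & (0 < mk (snk (pa v)) < mk v)%N]
    else snk (pa v) = v /\ (0 < mk (src (pa v)) < mk v)%N].

(* The marked nodes are those reached from the sources of positive excess;
   [mk] is the depth in the search tree, and [F] contains the support of [x]
   together with the tree edges. *)
Record search d x ex mk pa pot F : Prop := Search {
  search_opt : optimal d x ex pot F;
  search_closed : forall e, (e < n * m)%N -> F e ->
    (0 < x e)%N \/ (0 < mk (src e))%N /\ (0 < mk (snk e))%N;
  search_depth : forall v, (v < n + m)%N -> (0 < mk v)%N ->
    (mk v + unmarked mk <= n + m)%N;
  search_root : forall v, (v < n)%N -> (0 < ex v)%N -> (0 < mk v)%N;
  search_par : forall v, (v < n + m)%N -> (0 < mk v)%N ->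
    (v < n)%N /\ (0 < ex v)%N \/ parent x mk pa F v
}.

Definition sinks_done ex mk : Prop :=
  forall v, (n <= v < n + m)%N -> (0 < mk v)%N -> ex v = 0%N.

Definition excess ex : nat := (\sum_(i < n) ex i)%N.
Definition deficit ex : nat := (\sum_(j < m) ex (n + j))%N.

(** [F] shrinks back to the support here: tree edges without flow would violate the closure
    condition once their ends lose their marks. *)
Lemma search_start d x ex mk pa pot F :
  optimal d x ex pot F ->
  (forall v, (v < n + m)%N -> mk v = ((v < n) && (0 < ex v))%N) ->
  search d x ex mk pa pot (fun e => 0 < x e)%N /\ sinks_done ex mk.
Proof.
move=> [bal le eq sup fF] mkE; split; last first.
  by move=> v /andP[v1 v2]; rewrite mkE // [(v < n)%N]ltnNge v1.
split.
- split=> //; first by move=> e le1 xe; apply: eq => //; apply: sup.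
  by apply: forest_sub fF => e le1 xe; apply: sup.
- by move=> e _ xe; left.
- move=> v lv mv; rewrite /unmarked (bigD1 (Ordinal lv)) //=.
  have mv1 : mk v = 1%N by move: mv; rewrite mkE //; case: (_ && _).
  rewrite mv1 /= add0n.
  have sum1 : (\sum_(i < n + m) 1 = n + m)%N by rewrite sum1_card card_ord.
  rewrite -[leqRHS]sum1 [leqRHS](bigD1 (Ordinal lv)) //= leq_add2l.
  by apply: leq_sum => i _; case: eqP.
- by move=> v lv ev; rewrite mkE ?lv ?ev // ltn_addr.
- move=> v lv; rewrite mkE //; case: andP => // -[] *; by left.
Qed.

(** The residual arcs that leave the marked set. From source to sink there is no capacity, so every
    edge counts; backwards the edge must carry flow. *)
Definition crossing x mk e : bool :=
  (((0 < mk (src e)) && ~~ (0 < mk (snk e)))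
  || [&& 0 < x e, 0 < mk (snk e) & ~~ (0 < mk (src e))])%N.

(** The graph is complete bipartite: one source with excess is marked, so without crossing edges
    every sink is marked, hence saturated. *)
Lemma search_stuck d x ex mk pa pot F :
  search d x ex mk pa pot F -> sinks_done ex mk ->
  (forall e, (e < n * m)%N -> ~~ crossing x mk e) ->
  excess ex = 0%N \/ deficit ex = 0%N.
Proof.
move=> S sd nc; have [->|/eqP E] := eqVneq (excess ex) 0%N; [by left|right].
have [i ei] : exists i : 'I_n, (0 < ex i)%N.
  apply/existsP; apply: contra_notT E; rewrite negb_exists => /forallP H.
  by apply/eqP; rewrite sum_nat_eq0; apply/forallP => i; have := H i; lia.
have mi := search_root S (ltn_ord i) ei.
rewrite /deficit big1 // => j _; apply: sd; first by have := ltn_ord j; lia.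
have := nc _ (edge_lt (ltn_ord i) (ltn_ord j)).
by rewrite /crossing srcE // snkE // mi /=; lia.
Qed.

Lemma unmarked_upd mk v k : (v < n + m)%N -> mk v = 0%N ->
  (unmarked (upd mk v k.+1)).+1 = unmarked mk.
Proof.
move=> lv mv; rewrite /unmarked (bigD1 (Ordinal lv)) //=.
rewrite [in RHS](bigD1 (Ordinal lv)) //= {1}/upd eqxx mv eqxx /= add0n add1n.
apply: (congr1 S); apply: eq_bigr => i ne; rewrite /upd.
case: (nat_of_ord i =P v) => // E.
by case/eqP: ne; apply/val_inj.
Qed.

Lemma parent_mono x mk mk' pa pa' F F' v :
  mk' v = mk v -> pa' v = pa v ->
  (forall e, F e -> F' e) -> (forall u, (0 < mk u)%N -> mk' u = mk u) ->
  parent x mk pa F v -> parent x mk' pa' F' v.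
Proof.
move=> mv pv FF mm [p1 p2 p3]; split; rewrite ?pv ?mv //; first exact: FF.
case: ifP p3 => _.
  by case=> q1 q2 /andP[q3 q4]; split=> //; rewrite mm // q3 q4.
by case=> q1 /andP[q3 q4]; split=> //; rewrite mm // q3 q4.
Qed.

Definition slack pot e : R := c e - pot (src e) - pot (snk e).

Definition grown mk b : nat := if (0 < mk (src b))%N then snk b else src b.
Definition grower mk b : nat := if (0 < mk (src b))%N then src b else snk b.

(* If [b] is in the support, then its slack is 0 and the potentials are kept.
   Otherwise the set of marked nodes is closed under [F], so [b] extends the
   forest. *)
Lemma search_grow d x ex mk pa pot F b pot' mk' pa' :
  search d x ex mk pa pot F -> (b < n * m)%N -> crossing x mk b ->
  (0 < x b)%N \/
    (forall e, (e < n * m)%N -> crossing x mk e ->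
       x e = 0%N /\ slack pot b <= slack pot e) ->
  (forall v, (v < n + m)%N -> pot' v =
     if (0 < mk v)%N
     then if (v < n)%N then pot v + slack pot b else pot v - slack pot b
     else pot v) ->
  mk' = upd mk (grown mk b) (mk (grower mk b)).+1 ->
  pa' = upd pa (grown mk b) b ->
  (exists F', search d x ex mk' pa' pot' F') /\
  (unmarked mk' < unmarked mk)%N.
Proof.
move=> S lb cb bmin potE {mk'}-> {pa'}->.
have lsb := src_lt lb; have ltb := snk_lt lb; have gtb := snk_ge n m b.
have [gN g0 o0] : [/\ (grown mk b < n + m)%N, mk (grown mk b) = 0%N
    & (0 < mk (grower mk b))%N].
  move: cb; rewrite /crossing /grown /grower.
  by case: (posnP (mk (src b))) => [E|E] /=; rewrite ?E; split=> //; lia.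
have oN : (grower mk b < n + m)%N by rewrite /grower; case: ifP; lia.
have Umk := unmarked_upd (mk (grower mk b)) gN g0.
split; last by rewrite -Umk.
pose F' e := F e || (e == b).
have [[bal le eq sup fF] cl dep root par] := S.
set mk' := upd mk _ _; set pa' := upd pa _ _.
have mkm u : (0 < mk u)%N -> mk' u = mk u.
  by rewrite /mk' /upd; case: eqP => // ->; rewrite g0.
have mkp u : (0 < mk u)%N -> (0 < mk' u)%N by move=> H; rewrite mkm.
have bmk : (0 < mk' (src b))%N /\ (0 < mk' (snk b))%N.
  move: o0 (mkp (grower mk b)); rewrite /mk' /upd /grown /grower.
  by case: ifP => _ -> // ->; rewrite ?eqxx.
have opt' : optimal d x ex pot' F'.
  case: (posnP (x b)) => xb; last first.
    have s0 : slack pot b = 0.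
      by have := eq b lb (sup _ lb xb); rewrite /slack; lra.
    have pE v : (v < n + m)%N -> pot' v = pot v.
      by move=> lv; rewrite potE // s0 subr0 addr0 !if_same.
    have FF e : F' e -> F e by case/orP=> [//|/eqP ->]; apply: sup.
    split=> //.
    - by move=> e le1; rewrite !pE ?le ?snk_lt // ltn_addr // src_lt.
    - move=> e le1 Fe; rewrite !pE ?eq ?snk_lt ?FF //.
      by rewrite ltn_addr // src_lt.
    - by move=> e le1 xe; rewrite /F' sup.
    - by apply: forest_sub fF => e _ Fe; apply: FF.
  have {}bmin e : (e < n * m)%N -> crossing x mk e ->
      x e = 0%N /\ slack pot b <= slack pot e.
    by case: bmin => [|H]; [rewrite xb | exact: H].
  have b1 : (0 < mk (src b))%N /\ mk (snk b) = 0%N.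
    by move: cb; rewrite /crossing xb; lia.
  (* An edge of [F] with exactly one marked end would carry flow and cross, but all crossing edges
     have zero flow here. *)
  have Fcut e : (e < n * m)%N -> F e -> (0 < mk (src e))%N = (0 < mk (snk e))%N.
    move=> le1 Fe; case: (cl _ le1 Fe) => [xe|[-> ->]//].
    have : ~~ crossing x mk e by apply/negP => /(bmin _ le1)[]; lia.
    by rewrite /crossing xe /=; do 2 case: (0 < _)%N.
  have sb0 : 0 <= slack pot b by have := le b lb; rewrite /slack; lra.
  (* Marked sources rise and marked sinks fall by the same amount, so the sum changes only on edges
     with exactly one marked end. *)
  have potS e : (e < n * m)%N -> pot' (src e) + pot' (snk e) =
      pot (src e) + pot (snk e) +
      (if (0 < mk (src e))%N then slack pot b else 0) -
      (if (0 < mk (snk e))%N then slack pot b else 0).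
    move=> le1; have l1 := src_lt le1; have l2 := snk_lt le1.
    rewrite !potE //; last exact: ltn_addr.
    have -> : (snk e < n)%N = false by have := snk_ge n m e; lia.
    by rewrite l1; case: (0 < mk (src e))%N; case: (0 < mk (snk e))%N; ring.
  split=> //.
  - move=> e le1; rewrite potS //; have := le e le1.
    (* A crossing edge has room for the step by the choice of [b]; on the others the sum is
       unchanged or falls. *)
    case: (boolP (crossing x mk e)) => ce.
      have [_ +] := bmin _ le1 ce; move: sb0; rewrite /slack.
      by case: (0 < mk (src e))%N; case: (0 < mk (snk e))%N; lra.
    move: ce; rewrite /crossing.
    by case: (0 < mk (src e))%N; case: (0 < mk (snk e))%N => //= _; lra.
  - move=> e le1 /orP[Fe|/eqP ->].
      rewrite potS // eq // Fcut //; case: ifP => _; ring.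
    by rewrite potS //; case: b1 => -> -> /=; rewrite /slack; ring.
  - by move=> e le1 xe; rewrite /F' sup.
  - apply: (forest_add (S := fun v => (0 < mk v)%N)) => //.
      by case: b1.
    by case: b1 => _ ->.
exists F'; split=> //.
- move=> e le1 /orP[Fe|/eqP ->]; last by right.
  by case: (cl _ le1 Fe) => [|[? ?]]; [left | right; split; apply: mkp].
(* Depth rises by one while one fewer node is unmarked. This keeps every tree path short enough for
   a walk of n + m rounds. *)
- move=> v lv; rewrite {1}/mk' /upd; case: eqP => [E _|_ mv].
    have := dep _ oN o0; rewrite -Umk -/(upd _ _ _) -/mk'.
    by rewrite /mk' /upd E eqxx; lia.
  have := dep _ lv mv; rewrite -Umk -/mk' mkm //; lia.
- by move=> v lv ev; apply: mkp; apply: root.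
- move=> v lv; case: (v =P grown mk b) => [-> _|ne].
    right; split; rewrite /pa' {1}/upd eqxx //; first by rewrite /F' eqxx orbT.
    have mko : mk' (grower mk b) = mk (grower mk b) by exact: mkm.
    have mkg : mk' (grown mk b) = (mk (grower mk b)).+1 by rewrite /mk' /upd eqxx.
    rewrite mkg; rewrite /upd eqxx; move: mko o0 cb.
    rewrite /crossing /grown /grower; case: ifP => s1.
      by rewrite [(snk b < n)%N]ltnNge gtb /= => -> -> _; rewrite ltnSn.
    by rewrite lsb /= => -> -> /and3P[-> _ _]; rewrite ltnSn.
  rewrite {1}/mk' /upd; case: eqP => // _ mv.
  case: (par _ lv mv) => [|P]; [by left | right].
  apply: parent_mono P; rewrite ?mkm //; last by move=> e Fe; rewrite /F' Fe.
  by rewrite /pa' /upd; case: eqP.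
Qed.

End Search.

(** * Augmentation along tree paths and change of scale *)

Section Augment.
Variables (R : realType) (n m : nat) (c : nat -> R).

Local Notation src := (src m).
Local Notation snk := (snk n m).
Local Notation inc := (inc n m).
Local Notation flow := (flow n m).
Local Notation optimal := (optimal n m c).
Local Notation search := (search n m c).
Local Notation parent := (parent n m).
Local Notation excess := (excess n).
Local Notation deficit := (deficit n m).

Implicit Types (d x ex mk pa : nat -> nat) (pot : nat -> R) (F : nat -> bool).

Lemma incE e v : (e < n * m)%N ->
  inc e v = ((v == src e) + (v == snk e))%N :> nat.
Proof.
move=> le; rewrite /inc ![_ == v]eq_sym.
have := src_lt le; have := snk_ge n m e.
by case: eqP => [->|_]; case: eqP => //=; lia.
Qed.

(* The flow is one unit short at the sink [cur]; [cur = 0] means that the walk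
   has ended in a source with positive excess. *)
Definition walking d ex mk pa F t k x' ex' cur : Prop :=
  (forall e, (e < n * m)%N -> (0 < x' e)%N -> F e) /\
  if cur == 0%N then
    (forall v, (v < n + m)%N -> (flow x' v + ex' v)%N = d v) /\
    exists r, [/\ (r < n)%N
      & forall v, (v < n + m)%N -> (ex' v + (v == t) + (v == r))%N = ex v]
  else
    [/\ (n <= cur < n + m)%N, (0 < mk cur)%N /\ (mk cur + k <= n + m)%N,
        forall v, (v < n + m)%N -> (flow x' v + ex' v + (v == cur))%N = d v,
        forall v, (v < n + m)%N -> (ex' v + (v == t))%N = ex v
      & forall i, (i < n)%N -> (0 < mk i)%N -> (mk i < mk cur)%N ->
          (0 < ex i)%N \/ parent x' mk pa F i].

Lemma walking_start d x ex mk pa pot F t ex' :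
  search d x ex mk pa pot F -> (0 < n)%N -> (n <= t < n + m)%N ->
  (0 < mk t)%N -> (0 < ex t)%N ->
  ex' = upd ex t (ex t - 1)%N ->
  walking d ex mk pa F t 0 x ex' t.
Proof.
move=> S n0 lt mt et ->; have [[bal le eq sup fF] cl dep root par] := S.
split; first exact: sup.
have lt2 : (t < n + m)%N by case/andP: lt.
(* Node 0 is a source because n > 0, so 0 is free to signal the end of the walk. *)
case: eqP => [|_]; first by lia.
split=> //.
- by split=> //; have := dep _ lt2 mt; lia.
- move=> v lv; rewrite -bal // /upd; case: eqP => [->|_]; lia.
- move=> v lv; rewrite /upd; case: eqP => [->|_]; lia.
- by move=> i li mi _; have [[_ ?]|?] := par i (ltn_addr _ li) mi; [left|right].
Qed.

Lemma walking_step d x ex mk pa pot F t k x' ex' cur :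
  search d x ex mk pa pot F ->
  walking d ex mk pa F t k x' ex' cur -> (0 < n)%N -> (n <= t)%N ->
  (0 < cur)%N ->
  let e := pa cur in
  let x1 := upd x' e (x' e + 1)%N in
  let e' := pa (src e) in
  if (0 < ex' (src e))%N
  then walking d ex mk pa F t k.+1 x1 (upd ex' (src e) (ex' (src e) - 1)%N) 0
  else walking d ex mk pa F t k.+1 (upd x1 e' (x1 e' - 1)%N) ex' (snk e').
Proof.
move=> S [sup' W] n0 nt c0 /=; have [_ cl dep root par] := S.
move: W; case: eqP => [E|_ [lc [mc kc] bal exE pr]]; first by rewrite E in c0.
have lc2 : (cur < n + m)%N by case/andP: lc.
have ncn : (cur < n)%N = false by lia.
have [[]|[le Fe]] := par _ lc2 mc; rewrite ncn // => -[skE mks].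
set e := pa cur in le Fe skE mks *; set x1 := upd x' e _.
have li := src_lt le.
have liN : (src e < n + m)%N by rewrite ltn_addr.
have x1F e1 : (e1 < n * m)%N -> (0 < x1 e1)%N -> F e1.
  by move=> l1; rewrite /x1 /upd; case: eqP => [->//|_]; apply: sup'.
(* The unit added on [e] repairs the sink [cur] and moves the imbalance to the source of [e], which
   now sends one unit too many. *)
have bal1 v : (v < n + m)%N -> (flow x1 v + ex' v)%N = (d v + (v == src e))%N.
  move=> lv; have := flow_upd x' (x' e + 1)%N v le; have := bal v lv.
  by rewrite -/x1 incE // skE; nia.
have ex'E i : (i < n)%N -> ex' i = ex i.
  move=> l1; have := exE i (ltn_addr _ l1).
  have -> : (i == t) = false by lia.
  by rewrite addn0.
case: ifP => exi.
  split=> //=; split.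
    move=> v lv; have := bal1 v lv; rewrite /upd; case: eqP => [->|_]; lia.
  exists (src e); split=> // v lv; rewrite -exE // /upd.
  case: (v =P src e) => [E|_]; last by lia.
  by rewrite -E in exi *; lia.
have /andP[mk1 mk2] := mks.
(* A source without excess is not a root, so its parent edge carries flow that can be taken back. *)
have [ei|[le' Fe']] := pr _ li mk1 mk2; first by rewrite -ex'E // exi in ei.
rewrite li.
set e' := pa (src e) in le' Fe' *; case=> srE xe' mke'.
have x1e' : (0 < x1 e')%N.
  by rewrite /x1 /upd; case: eqP => [_|//]; lia.
have lt' := snk_lt le'; have gt' := snk_ge n m e'.
split.
  move=> e1 l1; rewrite /upd; case: eqP => [->//|_]; exact: x1F.
case: eqP => [|_]; first by lia.
split=> //.
- by rewrite lt' gt'.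
- by split; lia.
- move=> v lv; have := flow_upd x1 (x1 e' - 1)%N v le'; have := bal1 v lv.
  rewrite incE // srE.
  by case: (v == src e); case: (v == snk e') => /=; lia.
(* The parent edge of a source starts at that source, so the shallower sources keep theirs: the only
   edge lowered belongs to [src e]. *)
- move=> i l1 mi lmi; case: (pr i l1 mi) => [||P]; [by lia|by left|right].
  case: P => P1 P2; rewrite l1 => -[P3 P4 P5]; split=> //; rewrite l1; split=> //.
  rewrite /upd; case: eqP => [E|_].
    by move: lmi; rewrite -P3 E srE; lia.
  by rewrite /x1 /upd; case: eqP => // _; rewrite addn1.
Qed.

Lemma sum_ord_eq k r : (r < k)%N -> (\sum_(i < k) (val i == r) = 1)%N.
Proof.
move=> lr; rewrite (bigD1 (Ordinal lr)) //= eqxx big1 // => i ne.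
by case: eqP => // E; case/eqP: ne; apply/val_inj.
Qed.

Lemma walking_end d x ex mk pa pot F t k x' ex' cur :
  search d x ex mk pa pot F -> (n <= t < n + m)%N ->
  walking d ex mk pa F t k x' ex' cur -> (n + m <= k)%N ->
  optimal d x' ex' pot F /\
  (excess ex = (excess ex').+1 /\ deficit ex = (deficit ex').+1).
Proof.
move=> S lt [sup' W] lk; have [[bal le eq sup fF] cl dep root par] := S.
(* A walk still at a sink would have positive depth with [mk cur + k <= n + m], which is impossible
   after n + m rounds. *)
move: W; case: eqP => [_ [bal' [r [lr exE]]]|_ [_ []]]; last by lia.
split; first by split.
have tm : (t - n < m)%N by lia.
split.
  rewrite /excess (eq_bigr (fun i : 'I_n => ex' i + (val i == r))%N).
    by rewrite big_split /= sum_ord_eq // addn1.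
  move=> i _ /=; rewrite -exE; last exact: ltn_addr.
  have -> : (nat_of_ord i == t) = false by have := ltn_ord i; lia.
  by rewrite addn0.
rewrite /deficit (eq_bigr (fun j : 'I_m => ex' (n + j) + (val j == t - n))%N).
  by rewrite big_split /= sum_ord_eq // addn1.
move=> j _; rewrite -exE ?ltn_add2l //=.
by have := ltn_ord j; lia.
Qed.

Lemma optimal_double (b : nat -> nat) P x ex pot F x' ex' :
  optimal (fun v => b v %/ (P + P))%N x ex pot F ->
  (forall e, (e < n * m)%N -> x' e = (x e + x e)%N) ->
  (forall v, (v < n + m)%N -> ex' v = (ex v + ex v + (b v %/ P) %% 2)%N) ->
  optimal (fun v => b v %/ P)%N x' ex' pot F.
Proof.
move=> [bal le eq sup fF] xE exE; split=> //.
- move=> v lv.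
  have -> : flow x' v = (flow x v + flow x v)%N.
    by rewrite (flow_eq _ xE) /flow big_split.
  rewrite exE //; have := bal v lv; rewrite addnn -muln2 divnMA.
  by have := divn_eq (b v %/ P) 2; lia.
- by move=> e le1; rewrite xE // => xe; apply: sup => //; lia.
Qed.

Lemma excess_double (b : nat -> nat) ex ex' :
  (forall v, (v < n + m)%N -> ex' v = (ex v + ex v + b v %% 2)%N) ->
  excess ex = 0%N \/ deficit ex = 0%N ->
  (minn (excess ex') (deficit ex') <= n + m)%N.
Proof.
move=> exE; case=> /eqP; rewrite sum_nat_eq0 => /forallP E0.
  rewrite (leq_trans (geq_minl _ _)) // (leq_trans _ (leq_addr _ _)) //.
  rewrite -[leqRHS]card_ord -sum1_card; apply: leq_sum => i _.
  have := E0 i; rewrite exE ?ltn_addr //= => /eqP ->.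
  by rewrite -ltnS ltn_mod.
rewrite (leq_trans (geq_minr _ _)) // (leq_trans _ (leq_addl _ _)) //.
rewrite -[leqRHS]card_ord -sum1_card; apply: leq_sum => j _.
have := E0 j; rewrite exE ?ltn_add2l //= => /eqP ->.
by rewrite -ltnS ltn_mod.
Qed.

Lemma flow_handshake x :
  (\sum_(i < n) flow x i = \sum_(j < m) flow x (n + j))%N.
Proof.
apply/eqP; rewrite -(eqr_nat R) !natr_sum -subr_eq0.
(* With these signs the two ends of every edge cancel. *)
pose w v : R := if (v < n)%N then 1 else -1.
have := rflow_weight n m w (fun e => (x e)%:R); rewrite [RHS]big1; last first.
  move=> e _; rewrite /w src_lt // ltnNge snk_ge /=; ring.
rewrite big_split_ord /= => H0; apply/eqP; rewrite -[RHS]H0; congr (_ + _).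
  by apply: eq_bigr => i _; rewrite /w ltn_ord mul1r rflow_nat.
rewrite -sumrN; apply: eq_bigr => j _; rewrite /w ltnNge leq_addr /=.
by rewrite mulN1r rflow_nat.
Qed.

(** Excess and deficit agree when the margins are balanced, so if one vanishes, both do. *)
Lemma optimal_full (b : nat -> nat) x ex pot F :
  optimal b x ex pot F ->
  (\sum_(i < n) b i = \sum_(j < m) b (n + j))%N ->
  excess ex = 0%N \/ deficit ex = 0%N ->
  forall v, (v < n + m)%N -> flow x v = b v.
Proof.
move=> [bal _ _ _ _] sb E0.
have eE : (\sum_(i < n) b i = \sum_(i < n) flow x i + excess ex)%N.
  by rewrite -big_split /=; apply: eq_bigr => i _; rewrite bal // ltn_addr.
have dE : (\sum_(j < m) b (n + j) = \sum_(j < m) flow x (n + j) + deficit ex)%N.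
  by rewrite -big_split /=; apply: eq_bigr => j _; rewrite bal // ltn_add2l.
have hs := flow_handshake x.
have /eqP : excess ex = 0%N by lia.
have /eqP : deficit ex = 0%N by lia.
rewrite !sum_nat_eq0 => /forallP d0 /forallP e0 v lv; rewrite -bal //.
case: (ltnP v n) => lvn.
  by have /eqP /= -> := e0 (Ordinal lvn); rewrite addn0.
have lvm : (v - n < m)%N by lia.
by have /eqP /= := d0 (Ordinal lvm); rewrite subnKC // => ->; rewrite addn0.
Qed.

End Augment.

(** * The scaling algorithm *)

(* Arrays: [AX] is the flow, [AEx] the excess of a source or deficit of a sink,
   [AMk] the depth in the search tree (0 if unreached), [APa] the parent edge.
   Scalars in [ASc]: 0 is the scale P, 1 the sum of the inputs, 2 the edge found
   by the scan (n * m if there is none), 3 the current node.  In [rv], 0 is the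
   dual step and v + 1 the potential of node v. *)
Definition Scl k := Ld ASc (Cst k).
Definition Pos e := NLe (Cst 1) e.
Definition Or b1 b2 := Not (And (Not b1) (Not b2)).
Definition esrc e := ADiv e Am.
Definition esnk e := AAdd An (AMod e Am).
Definition epot v := Rv (AAdd v (Cst 1)).
Definition eslack e := RMinus (RMinus (Cost e) (epot (esrc e))) (epot (esnk e)).
Definition ecross e :=
  Or (And (Pos (Ld AMk (esrc e))) (Not (Pos (Ld AMk (esnk e)))))
     (And (Pos (Ld AX e))
          (And (Pos (Ld AMk (esnk e))) (Not (Pos (Ld AMk (esrc e)))))).

(** A crossing edge with flow always wins; otherwise an edge of minimal slack is kept. *)
Definition scan_better :=
  And (ecross Cnt)
   (Or (Pos (Ld AX Cnt))
   (Or (NLe Anm (Scl 2))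
       (And (Not (Pos (Ld AX (Scl 2)))) (RLe (eslack Cnt) (eslack (Scl 2)))))).

Definition scan :=
  PSeq (Sl (SN ASc (Cst 2) Anm))
       (For Edges (SIf scan_better (SN ASc (Cst 2) Cnt) SSkip)).

Definition double_flow :=
  For Edges (SN AX Cnt (AAdd (Ld AX Cnt) (Ld AX Cnt))).

Definition refill :=
  For Nodes (SN AEx Cnt (AAdd (AAdd (Ld AEx Cnt) (Ld AEx Cnt))
                              (AMod (ADiv (Inp Cnt) (Scl 0)) (Cst 2)))).

(** Halving the scale 1 yields 0, which stops the main loop; the flow is then at full scale and must
    not be doubled again. *)
Definition phase :=
  PSeq (Sl (SN ASc (Cst 0) (ADiv (Scl 0) (Cst 2))))
       (PIf (Pos (Scl 0)) (PSeq double_flow refill) (Sl SSkip)).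

Definition reset :=
  For Nodes (SIf (And (Not (NLe An Cnt)) (Pos (Ld AEx Cnt)))
                 (SN AMk Cnt (Cst 1)) (SN AMk Cnt (Cst 0))).

(** The slack is saved first because the loop overwrites the potentials it is computed from. On an
    edge with flow it is 0, and nothing changes. *)
Definition dual_step :=
  PSeq (Sl (SR (Cst 0) (eslack (Scl 2))))
       (For Nodes (SIf (Pos (Ld AMk Cnt))
                     (SIf (NLe An Cnt)
                       (SR (AAdd Cnt (Cst 1)) (RMinus (epot Cnt) (Rv (Cst 0))))
                       (SR (AAdd Cnt (Cst 1)) (RPlus (epot Cnt) (Rv (Cst 0)))))
                     SSkip)).

Definition mark_node new old :=
  SSeq (SN AMk new (AAdd (Ld AMk old) (Cst 1)))
       (SSeq (SN APa new (Scl 2)) (SN ASc (Cst 3) new)).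

Definition mark :=
  Sl (SIf (Pos (Ld AMk (esrc (Scl 2))))
          (mark_node (esnk (Scl 2)) (esrc (Scl 2)))
          (mark_node (esrc (Scl 2)) (esnk (Scl 2)))).

(** [e] and [i] are expressions evaluated anew at each use, hence the current node is overwritten
    last. *)
Definition walk :=
  let e := Ld APa (Scl 3) in
  let i := esrc e in
  SIf (Pos (Scl 3))
    (SSeq (SN AX e (AAdd (Ld AX e) (Cst 1)))
      (SIf (Pos (Ld AEx i))
         (SSeq (SN AEx i (ASub (Ld AEx i) (Cst 1))) (SN ASc (Cst 3) (Cst 0)))
         (SSeq (SN AX (Ld APa i) (ASub (Ld AX (Ld APa i)) (Cst 1)))
               (SN ASc (Cst 3) (esnk (Ld APa i))))))
    SSkip.

Definition augment :=
  PSeq (Sl (SN AEx (Scl 3) (ASub (Ld AEx (Scl 3)) (Cst 1))))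
       (PSeq (For Nodes walk) reset).

(** Each round makes one scan and one move: a change of scale, or one new node, possibly with an
    augmentation. The nested loops of the scaling method thus become a single one. *)
Definition body :=
  PSeq scan
   (PIf (NLe Anm (Scl 2))
      (PSeq phase reset)
      (PSeq dual_step
        (PSeq mark
          (PIf (And (NLe An (Scl 3)) (Pos (Ld AEx (Scl 3))))
               augment (Sl SSkip))))).

Section Algorithm.
Variables (R : realType) (n m : nat) (inp : nat -> nat).

Local Notation prun := (@prun R n m inp).
Local Notation abeval := (@abeval R n m inp).
Local Notation areval := (@areval R n m inp).
Local Notation aeval := (@aeval R n m inp).
Local Notation crossing := (crossing n m).
Local Notation slack := (slack n m).

Implicit Types A : ast R.

Definition pot A v : R := rv A (v + 1)%N.

Definition same_but (k : arr) A A' : Prop :=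
  [/\ forall k', code k' != code k -> nv A' k' = nv A k',
      cv A' = cv A & rv A' = rv A].

Lemma abeval_or A b1 b2 : abeval A (Or b1 b2) = abeval A b1 || abeval A b2.
Proof. by rewrite /= negb_and !negbK. Qed.

Lemma abeval_and A b1 b2 : abeval A (And b1 b2) = abeval A b1 && abeval A b2.
Proof. by []. Qed.

Lemma abeval_cross A e :
  abeval A (ecross e) = crossing (nv A AX) (nv A AMk) (aeval A e).
Proof. by rewrite abeval_or. Qed.

Lemma areval_slack A e : (aeval A e < n * m)%N ->
  areval A (eslack e) = slack (cv A) (pot A) (aeval A e).
Proof. by move=> le; rewrite /= modn_small. Qed.

Definition scanned x mk (c : nat -> R) p k b : Prop :=
  b = (n * m)%N /\ (forall e, (e < k)%N -> ~~ crossing x mk e) \/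
  [/\ (b < n * m)%N, crossing x mk b &
      (0 < x b)%N \/
      (forall e, (e < k)%N -> crossing x mk e ->
         x e = 0%N /\ slack c p b <= slack c p e)].

Lemma scan_spec A (A' := prun scan A) :
  [/\ same_but ASc A A', nv A' ASc 0 = nv A ASc 0
    & scanned (nv A AX) (nv A AMk) (cv A) (pot A) (n * m) (nv A' ASc 2)].
Proof.
pose Inv k A1 := [/\ same_but ASc A A1, nv A1 ASc 0 = nv A ASc 0
    & scanned (nv A AX) (nv A AMk) (cv A) (pot A) k (nv A1 ASc 2)].
apply: (@for_ind R n m inp Inv Edges) => [|k A1 lk ck [[sN sC sR] s0 sc]].
  by split=> //; [split=> // -[]|left].
have x1 : nv A1 AX = nv A AX by exact: sN.
have mk1 : nv A1 AMk = nv A AMk by exact: sN.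
have pot1 : pot A1 = pot A by rewrite /pot sR.
have lk' : (k < n * m)%N by [].
have cE : abeval A1 scan_better = crossing (nv A AX) (nv A AMk) k &&
   [|| 0 < nv A AX k, n * m <= nv A1 ASc 2
     | ~~ (0 < nv A AX (nv A1 ASc 2)) &&
       (areval A1 (eslack Cnt) <= areval A1 (eslack (Scl 2)))%R]%N.
  by rewrite abeval_and abeval_cross !abeval_or abeval_and -x1 -mk1 -ck.
rewrite -[srun _ _ _ _ _]/(if abeval A1 scan_better
  then setn ASc 2 (cnt A1) A1 else A1).
rewrite cE; set b := nv A1 ASc 2 in sc cE *.
have -> : areval A1 (eslack Cnt) = slack (cv A) (pot A) k.
  by rewrite areval_slack /= ck // sC pot1.
(* For b = n * m the index wraps around and the slack is meaningless, so its value is only claimed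
   for genuine edges. *)
have : (b < n * m)%N -> areval A1 (eslack (Scl 2)) = slack (cv A) (pot A) b.
  by move=> lb; rewrite areval_slack // sC pot1.
move: (areval A1 (eslack (Scl 2))) => rb rbE.
case: (boolP (crossing _ _ k)) => crk; last first.
  split=> //=; case: sc => [[Eb H]|[lb cb H]]; [left|right].
    split=> // e; rewrite ltnS leq_eqVlt => /orP[/eqP->//|]; exact: H.
  split=> //; case: H => [|H]; [by left|right] => e.
  rewrite ltnS leq_eqVlt => /orP[/eqP->|]; first by rewrite (negbTE crk).
  exact: H.
rewrite /=; case: ifP => cond; split=> //=.
- by split=> // k' nk /=; rewrite (negbTE nk) sN.
- rewrite [upd _ _ _ _]/upd /= ck; right; split=> //.
  case: posnP cond => [xk|xk] /= cond; [right|by left].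
  move=> e; rewrite ltnS leq_eqVlt => /orP[/eqP->//|lek] ce.
  case: sc cond => [[-> H] _|[lb cb H]].
    by have := H e lek; rewrite ce.
  rewrite leqNgt lb /=; case: H => [->//|H] /andP[xb].
  rewrite rbE // => sl; have [-> sl'] := H e lek ce.
  by split=> //; apply: le_trans sl'.
- case: posnP cond => // xk /=.
  case: sc => [[-> _]|[lb cb H]]; first by rewrite leqnn.
  rewrite leqNgt lb /= => cond; right; split=> //.
  case: posnP cond => xb cond; [right|by left].
  move=> e; rewrite ltnS leq_eqVlt => /orP[/eqP->|lek] ce; last first.
    by case: H => [|H]; [rewrite xb | exact: H].
  split=> //; move: cond; rewrite rbE // /=.
  by move/negbT; rewrite -ltNge => /ltW.
Qed.

Lemma reset_spec A (A' := prun reset A) :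
  same_but AMk A A' /\
  forall v, (v < n + m)%N -> nv A' AMk v = ((v < n) && (0 < nv A AEx v))%N.
Proof.
pose Inv k A1 := same_but AMk A A1 /\
  forall v, (v < k)%N -> nv A1 AMk v = ((v < n) && (0 < nv A AEx v))%N.
apply: (@for_ind R n m inp Inv Nodes) => [|k A1 lk ck [[sN sC sR] H]].
  by split.
have ex1 : nv A1 AEx = nv A AEx by exact: sN.
have -> : srun n m inp (SIf (And (Not (NLe An Cnt)) (Pos (Ld AEx Cnt)))
    (SN AMk Cnt (Cst 1)) (SN AMk Cnt (Cst 0))) A1 =
    setn AMk k ((k < n) && (0 < nv A AEx k))%N A1.
  by rewrite /= ck ex1 -ltnNge; case: (_ && _).
split=> /=.
  by split=> // k' nk /=; rewrite (negbTE nk) sN.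
move=> v; rewrite ltnS leq_eqVlt /= /upd => /orP[/eqP ->|lv].
  by rewrite eqxx.
by rewrite (ltn_eqF lv) H.
Qed.

Lemma phase_spec A (A' := prun phase A) (P := (nv A ASc 0 %/ 2)%N) :
  [/\ cv A' = cv A, rv A' = rv A, nv A' ASc 0 = P
    & if P == 0%N
      then nv A' AX = nv A AX /\ nv A' AEx = nv A AEx
      else (forall e, (e < n * m)%N -> nv A' AX e = (nv A AX e + nv A AX e)%N) /\
        forall v, (v < n + m)%N -> nv A' AEx v =
          (nv A AEx v + nv A AEx v + inp v %/ P %% 2)%N].
Proof.
pose A0 := setn ASc 0 P A.
have P0 : nv A0 ASc 0 = P by [].
rewrite /A' -[prun phase A]/(if abeval A0 (Pos (Scl 0))
  then prun refill (prun double_flow A0) else A0).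
rewrite -[abeval A0 _]/(0 < P)%N.
case: posnP => [_|Pgt]; first by split.
set A1 := prun double_flow A0.
have [sN1 sC1 sR1 x1] : [/\ nv A1 AEx = nv A AEx /\ nv A1 ASc 0 = P,
    cv A1 = cv A, rv A1 = rv A &
    forall e, (e < n * m)%N -> nv A1 AX e = (nv A AX e + nv A AX e)%N].
  pose Inv k A1 := [/\ nv A1 AEx = nv A AEx /\ nv A1 ASc 0 = P,
    cv A1 = cv A, rv A1 = rv A &
    forall e, nv A1 AX e = (nv A AX e + (if e < k then nv A AX e else 0))%N].
  suff [? ? ? H] : Inv (n * m)%N A1.
    by split=> // e le; rewrite H le.
  apply: (@for_ind R n m inp Inv Edges) => [|k A2 lk ck [[sN1 sN2] sC sR H]].
    by split=> // e; rewrite addn0.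
  split=> //= e; rewrite ck /upd !H ltnn addn0 ltnS.
  by rewrite [in RHS]leq_eqVlt; case: eqP => [->|].
set A2 := prun refill A1.
pose Inv k A2 := [/\ nv A2 AX = nv A1 AX /\ nv A2 ASc 0 = P,
    cv A2 = cv A, rv A2 = rv A &
    forall v, nv A2 AEx v = (if v < k then
      nv A AEx v + nv A AEx v + inp v %/ P %% 2 else nv A AEx v)%N].
suff [[xE ?] ? ? H] : Inv (n + m)%N A2.
  by split=> //; split=> [e le|v lv]; [rewrite xE x1 | rewrite H lv].
case: sN1 => sN1 sN2.
apply: (@for_ind R n m inp Inv Nodes) => [|k A3 lk ck [[sN3 sN4] sC sR H]].
  by split=> // v; rewrite sN1.
split=> //= v; rewrite ck /upd !H ltnn (@modn_small k (n + m)) // sN4 ltnS.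
by rewrite [in RHS]leq_eqVlt; case: eqP => [->|].
Qed.

Lemma dual_step_spec A (A' := prun dual_step A) :
  (nv A ASc 2 < n * m)%N ->
  [/\ nv A' = nv A, cv A' = cv A &
    forall v, (v < n + m)%N -> pot A' v =
      if (0 < nv A AMk v)%N
      then if (v < n)%N
           then pot A v + slack (cv A) (pot A) (nv A ASc 2)
           else pot A v - slack (cv A) (pot A) (nv A ASc 2)
      else pot A v].
Proof.
move=> lb; set s := slack _ _ _.
pose f v := if (0 < nv A AMk v)%N
      then if (v < n)%N then pot A v + s else pot A v - s else pot A v.
pose Inv k A1 := [/\ nv A1 = nv A, cv A1 = cv A, rv A1 0%N = s &
  forall v, pot A1 v = if (v < k)%N then f v else pot A v].
suff [? ? _ H] : Inv (n + m)%N A' by split=> // v lv; rewrite H lv.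
apply: (@for_ind R n m inp Inv Nodes) => [|k A1 lk ck [sN sC s0 H]].
  have -> : srun n m inp (SR (Cst 0) (eslack (Scl 2))) A =
    Ast (nv A) (cv A) (upd (rv A) 0 s) (cnt A).
    rewrite -[LHS]/(Ast (nv A) (cv A) (upd (rv A) 0 (areval A _)) (cnt A)).
    by rewrite areval_slack.
  by split=> // v; rewrite /pot /= /upd addn1.
have potk : rv A1 (k + 1)%N = pot A k by have := H k; rewrite ltnn.
have fE : srun n m inp (SIf (Pos (Ld AMk Cnt)) (SIf (NLe An Cnt)
   (SR (AAdd Cnt (Cst 1)) (RMinus (epot Cnt) (Rv (Cst 0))))
   (SR (AAdd Cnt (Cst 1)) (RPlus (epot Cnt) (Rv (Cst 0))))) SSkip) A1 =
   if (0 < nv A AMk k)%N then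
     Ast (nv A1) (cv A1) (upd (rv A1) (k + 1) (f k)) (cnt A1) else A1.
  rewrite /= ck sN s0 potk /f; case: ifP => // mk.
  by case: (ltnP k n).
rewrite fE.
have {}H v : pot (if (0 < nv A AMk k)%N then
     Ast (nv A1) (cv A1) (upd (rv A1) (k + 1) (f k)) (cnt A1) else A1) v =
     if (v <= k)%N then f v else pot A v.
  rewrite [(v <= k)%N]leq_eqVlt; case: (v =P k) => [->|/eqP ne] /=.
    case: ifP => mk; first by rewrite /pot /= /upd eqxx.
    by rewrite /f mk; have := H k; rewrite ltnn.
  by case: ifP => mk; rewrite -H // /pot /= /upd eqn_add2r (negbTE ne).
split=> //.
- by case: ifP.
- by case: ifP.
(* Potentials occupy cells from 1 on, so the step saved in cell 0 survives the loop. *)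
- by case: ifP => //= _; rewrite /upd addn1.
Qed.

End Algorithm.

(** * Invariant and termination of the main loop *)

Section Main.
Variables (R : realType) (n m : nat) (inp : nat -> nat).
Hypotheses (n_gt0 : (0 < n)%N) (m_gt0 : (0 < m)%N).

Local Notation src := (src m).
Local Notation snk := (snk n m).
Local Notation flow := (flow n m).
Local Notation prun := (@prun R n m inp).
Local Notation abeval := (@abeval R n m inp).
Local Notation slack := (slack n m).
Local Notation optimal := (optimal n m).
Local Notation search := (search n m).
Local Notation excess := (excess n).
Local Notation deficit := (deficit n m).
Local Notation unmarked := (unmarked n m).
Local Notation sinks_done := (sinks_done n m).
Local Notation grown := (grown n m).
Local Notation grower := (grower n m).

Implicit Types A : ast R.

Lemma mark_spec A (mk := nv A AMk) (b := nv A ASc 2) :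
  prun mark A =
  setn ASc 3 (grown mk b)
    (setn APa (grown mk b) b (setn AMk (grown mk b) (mk (grower mk b) + 1) A)).
Proof.
rewrite /grown /grower -[LHS]/(if (0 < mk (src b))%N
  then srun n m inp (mark_node (esnk (Scl 2)) (esrc (Scl 2))) A
  else srun n m inp (mark_node (esrc (Scl 2)) (esnk (Scl 2))) A).
by case: ifP.
Qed.

Lemma augment_spec d F A (A' := prun augment A) (t := nv A ASc 3) :
  search (cv A) d (nv A AX) (nv A AEx) (nv A AMk) (nv A APa) (pot A) F ->
  (n <= t < n + m)%N -> (0 < nv A AMk t)%N -> (0 < nv A AEx t)%N ->
  [/\ cv A' = cv A, rv A' = rv A, nv A' ASc 0 = nv A ASc 0
    & [/\ optimal (cv A) d (nv A' AX) (nv A' AEx) (pot A) F,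
        excess (nv A AEx) = (excess (nv A' AEx)).+1,
        deficit (nv A AEx) = (deficit (nv A' AEx)).+1
      & forall v, (v < n + m)%N ->
          nv A' AMk v = ((v < n) && (0 < nv A' AEx v))%N]].
Proof.
move=> S lt mt et.
pose A0 := setn AEx t (nv A AEx t - 1) A.
pose A1 := prun (For Nodes walk) A0.
have [[sN sC sR] rE] := reset_spec n m inp A1.
pose Inv k A1 := [/\ cv A1 = cv A, rv A1 = rv A, nv A1 ASc 0 = nv A ASc 0,
  nv A1 AMk = nv A AMk /\ nv A1 APa = nv A APa &
  walking n m d (nv A AEx) (nv A AMk) (nv A APa) F t k
    (nv A1 AX) (nv A1 AEx) (nv A1 ASc 3)].
have [cE rE' pE _ W] : Inv (n + m)%N A1.
  apply: (@for_ind R n m inp Inv Nodes) => [|k A2 lk ck [cE rE' pE [mE aE] W]].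
    by split=> //; apply: (walking_start S).
  set cur := nv A2 ASc 3 in W *; set e := nv A2 APa cur.
  pose B := setn AX e (nv A2 AX e + 1) A2; set e' := nv A2 APa (src e).
  have -> : srun n m inp walk A2 = if (0 < cur)%N then
      if (0 < nv A2 AEx (src e))%N
      then setn ASc 3 0 (setn AEx (src e) (nv A2 AEx (src e) - 1) B)
      else setn ASc 3 (snk e') (setn AX e' (nv B AX e' - 1) B)
    else A2 by [].
  (* Once the walk has ended, the remaining rounds change nothing. *)
  case: posnP => [c0|c0].
    split=> //; move: W; rewrite /= -/cur c0 => -[W1 W2]; split=> //.
  have := walking_step S W n_gt0 _ c0.
  rewrite /= -aE -/e -/e'; have nt : (n <= t)%N by case/andP: lt.
  by move=> /(_ nt); case: ifP => _ W'; split=> //=; rewrite -aE.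
have [opt [eE dE]] := walking_end S lt W (leqnn _).
rewrite /A' -[prun augment A]/(prun reset A1).
rewrite (sN AX) // (sN AEx) // (sN ASc) // sC sR; split=> //.
Qed.

Definition full (c : nat -> R) x p : Prop :=
  exists ex F, optimal c inp x ex p F /\
    forall v, (v < n + m)%N -> flow x v = inp v.

Definition main_inv c A : Prop :=
  cv A = c /\
  (nv A ASc 0 = 0%N /\ full c (nv A AX) (pot A) \/
   exists K F, [/\ nv A ASc 0 = (2 ^ K)%N,
     search c (fun v => inp v %/ 2 ^ K)%N
       (nv A AX) (nv A AEx) (nv A AMk) (nv A APa) (pot A) F
   & sinks_done (nv A AEx) (nv A AMk)]).

Definition phases P : nat := if P == 0%N then 0%N else (trunc_log 2 P).+1.

(** A lexicographic measure: phases left, units that can still be sent, nodes not yet reached. With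
    N = n + m, at most N units wait after a doubling and at most N nodes are unmarked, and N * (N +
    1) + N is below the weight of a phase. *)
Definition main_mu A : nat :=
  (phases (nv A ASc 0) * ((n + m).+1 * (n + m).+2)
   + minn (excess (nv A AEx)) (deficit (nv A AEx)) * (n + m).+1
   + unmarked (nv A AMk))%N.

Lemma phases_exp K : phases (2 ^ K)%N = K.+1.
Proof. by rewrite /phases expn_eq0 /= trunc_expnK. Qed.

Lemma unmarked_le mk : (unmarked mk <= n + m)%N.
Proof.
rewrite -[leqRHS]card_ord -sum1_card; apply: leq_sum => i _; exact: leq_b1.
Qed.

Lemma body_spec c A :
  (\sum_(i < n) inp i = \sum_(j < m) inp (n + j))%N ->
  main_inv c A -> abeval A (Pos (Scl 0)) ->
  main_inv c (prun body A) /\ (main_mu (prun body A) < main_mu A)%N.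
Proof.
move=> inpB [cE MI] P0.
have {MI} [K [F [PE S sd]]] : exists K F, [/\ nv A ASc 0 = (2 ^ K)%N,
     search c (fun v => inp v %/ 2 ^ K)%N
       (nv A AX) (nv A AEx) (nv A AMk) (nv A APa) (pot A) F
   & sinks_done (nv A AEx) (nv A AMk)].
  case: MI => [[E _]|//]; by rewrite -[X in is_true X]/(0 < nv A ASc 0)%N E in P0.
have [[sN sC sR] s0 sc] := scan_spec n m inp A.
set A1 := prun scan A in sN sC sR s0 sc.
have x1 : nv A1 AX = nv A AX by exact: sN.
have ex1 : nv A1 AEx = nv A AEx by exact: sN.
have mk1 : nv A1 AMk = nv A AMk by exact: sN.
have pa1 : nv A1 APa = nv A APa by exact: sN.
have pot1 : pot A1 = pot A by rewrite /pot sR.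
have muE : main_mu A1 = main_mu A by rewrite /main_mu s0 ex1 mk1.
rewrite -muE; set b := nv A1 ASc 2 in sc.
pose A2 := prun phase A1.
pose A3 := prun dual_step A1.
pose A4 := prun mark A3.
rewrite -[prun body A]/(if (n * m <= b)%N then prun reset A2 else
  if (n <= nv A4 ASc 3)%N && (0 < nv A4 AEx (nv A4 ASc 3))%N
  then prun augment A4 else A4).
have [opt _ _ _ _] := S.
case: sc => [[-> nc]|[lb cb bmin]].
  rewrite leqnn.
  have ED := search_stuck S sd nc.
  have [cE2 rE2 PE2 H2] := phase_spec n m inp A1.
  have [[sN3 sC3 sR3] mkE] := reset_spec n m inp A2.
  rewrite -/A2 in cE2 rE2 PE2 H2.
  set A3' := prun reset A2 in sN3 sC3 sR3 mkE *.
  have x3 : nv A3' AX = nv A2 AX by exact: sN3.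
  have ex3 : nv A3' AEx = nv A2 AEx by exact: sN3.
  have p3 : nv A3' ASc 0 = nv A2 ASc 0 by rewrite sN3.
  have pot3 : pot A3' = pot A by rewrite /pot sR3 rE2 sR.
  have um := unmarked_le (nv A3' AMk).
  rewrite s0 PE in PE2 H2; case: K PE S opt PE2 H2 => [|K] PE S opt PE2 H2.
    move: H2 => /= [x2 ex2].
    rewrite /main_inv /main_mu p3 PE2 ex3 ex2 s0 PE; split.
      split; first by rewrite sC3 cE2 sC.
      left; split=> //; exists (nv A AEx), F.
      have Ed : (fun v => inp v %/ 2 ^ 0)%N = inp.
        by apply/funext => v; rewrite expn0 divn1.
      rewrite Ed in opt; rewrite x3 x2 x1 pot3; split=> //.
      exact: (optimal_full opt).
    by rewrite /phases /= trunc_log1 !mul1n !mul0n; nia.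
  have PK : (2 ^ K.+1 %/ 2 = 2 ^ K)%N by rewrite expnS mulKn.
  rewrite PK expn_eq0 /= in PE2 H2; case: H2 => x2 ex2.
  have opt3 : optimal c (fun v => inp v %/ 2 ^ K)%N
      (nv A3' AX) (nv A3' AEx) (pot A3') F.
    rewrite x3 ex3 pot3; apply: (optimal_double (x := nv A AX) (ex := nv A AEx)).
    - by move: opt; rewrite expnS mul2n addnn.
    - by move=> e le; rewrite x2 // x1.
    - by move=> v lv; rewrite ex2 // ex1.
  rewrite -ex3 in mkE.
  have [S3 sd3] := search_start (nv A3' APa) opt3 mkE.
  split.
    split; first by rewrite sC3 cE2 sC.
    by right; exists K, (fun e => 0 < nv A3' AX e)%N; rewrite p3.
  rewrite /main_mu p3 PE2 s0 PE !phases_exp.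
  have E3 v : (v < n + m)%N -> nv A3' AEx v =
      (nv A AEx v + nv A AEx v + inp v %/ 2 ^ K %% 2)%N.
    by move=> lv; rewrite ex3 ex2 // ex1.
  by have := excess_double (b := fun v => (inp v %/ 2 ^ K)%N) E3 ED; nia.
rewrite ifN -?ltnNge //.
have [nvE cE3 potE] := dual_step_spec inp lb.
rewrite -/A3 in nvE cE3 potE.
have A4E := mark_spec A3; rewrite -/A4 nvE mk1 -/b in A4E.
set w := grown (nv A AMk) b in A4E.
have x4 : nv A4 AX = nv A AX by rewrite A4E /= nvE x1.
have ex4 : nv A4 AEx = nv A AEx by rewrite A4E /= nvE ex1.
have mk4 : nv A4 AMk = upd (nv A AMk) w (nv A AMk (grower (nv A AMk) b)).+1.
  by rewrite A4E /= nvE mk1 addn1.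
have pa4 : nv A4 APa = upd (nv A APa) w b by rewrite A4E /= nvE pa1.
have p4 : nv A4 ASc 0 = (2 ^ K)%N by rewrite A4E /= nvE /upd /= s0.
have w4 : nv A4 ASc 3 = w by rewrite A4E /= /upd.
have c4 : cv A4 = c by rewrite A4E /= cE3 sC.
have r4 : pot A4 = pot A3 by rewrite A4E.
rewrite sC cE in bmin potE.
have potE4 v : (v < n + m)%N -> pot A4 v = if (0 < nv A AMk v)%N
    then if (v < n)%N then pot A v + slack c (pot A) b
         else pot A v - slack c (pot A) b
    else pot A v.
  by move=> lv; rewrite r4 potE // mk1 pot1.
have [[F4 S4] um] := search_grow S lb cb bmin potE4 mk4 pa4.
have lw : (w < n + m)%N.
  by rewrite /w /grown; case: ifP => _; rewrite ?snk_lt // ltn_addr // src_lt.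
have mkw : (0 < nv A4 AMk w)%N by rewrite mk4 /upd eqxx.
rewrite w4 ex4; case: ifP => [/andP[nw ew]|nw]; last first.
  split; last first.
    by rewrite /main_mu p4 s0 PE ex4 ex1 mk1 ltn_add2l.
  split=> //; right; exists K, F4; split=> //; first by rewrite x4 ex4.
  (* Only [w] is newly marked; a sink [w] with a deficit would have led to an augmentation. *)
  move=> v lv; rewrite mk4 ex4 /upd; case: eqP => [E _|_]; last exact: sd.
  by move: nw; rewrite -E; case/andP: lv => ->; lia.
have S4' : search (cv A4) (fun v => inp v %/ 2 ^ K)%N (nv A4 AX) (nv A4 AEx)
    (nv A4 AMk) (nv A4 APa) (pot A4) F4 by rewrite c4 x4 ex4.
have := augment_spec S4'; rewrite w4 nw lw ex4 => /(_ isT mkw ew).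
set A5 := prun augment A4; case=> c5 r5 p5 [opt5 e5 d5 mk5].
rewrite c4 in opt5 c5; have pot5 : pot A5 = pot A4 by rewrite /pot r5.
rewrite -pot5 in opt5.
have [S5 sd5] := search_start (nv A5 APa) opt5 mk5.
split.
  split=> //; right; exists K, (fun e => 0 < nv A5 AX e)%N.
  by rewrite p5 p4.
rewrite /main_mu p5 p4 s0 PE ex1 e5 d5 minnSS mulSn.
by have := unmarked_le (nv A5 AMk); lia.
Qed.

End Main.

(** * The complete program *)

Definition prep :=
  PSeq (Sl (SN ASc (Cst 0) (Cst 1)))
       (For Nodes (SN ASc (Cst 1) (AAdd (Scl 1) (Inp Cnt)))).

(** Repeated until the scale exceeds the sum of all inputs, so that every margin is truncated to 0
    at the start. *)
Definition scale := Sl (SN ASc (Cst 0) (AAdd (Scl 0) (Scl 0))).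

Definition write_out := For Edges (SC Cnt (OfN (Ld AX Cnt))).

(* Multiplication is not available, so n * m is computed by a loop. *)
Definition cinit :=
  While (BNLe (NAdd (NLoad cCadr) (NConst 1)) (NLoad (NConst 0)))
    (Seq (NStore cMadr (NAdd cM (NLoad (NConst 1)))) cincr).

Definition transport_alg :=
  If (BNLe (NConst 1) (NLoad (NConst 0)))
    (Seq cinit (Seq (cp prep)
      (Seq (While (cb (NLe (Scl 0) (Scl 1))) (cp scale))
        (Seq (While (cb (Pos (Scl 0))) (cp body)) (cp write_out)))))
    Skip.

Section Correctness.
Variables (R : realType) (n m : nat) (inp : nat -> nat).
Hypotheses (n_gt0 : (0 < n)%N) (m_gt0 : (0 < m)%N).

Implicit Types (A : ast R) (s : state R).

Local Notation prun := (@prun R n m inp).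
Local Notation abeval := (@abeval R n m inp).

Definition Ast0 c k : ast R := Ast (fun _ _ => 0%N) c (fun _ => 0) k.

Definition Tinit := (btime (BNLe (NAdd (NLoad cCadr) (NConst 1)) (NLoad (NConst 0)))
  + ((ntime cMadr + ntime (NAdd cM (NLoad (NConst 1)))).+1 + tincr)).+1.

(** The cell for n * m is not yet correct, so [represents] fails and this loop is verified directly
    on the machine. Its counter ends at n, whence [Ast0 c n]. *)
Lemma init_spec c s :
  nmem s 0 = n -> nmem s 1 = m ->
  (forall v, (v < n + m)%N -> nmem s (2 + v)%N = inp v) ->
  (forall a, (n + m + 2 <= a)%N -> nmem s a = 0%N) ->
  (forall e, (e < n * m)%N -> rmem s e = c e) ->
  (forall i, rmem s (n * m + n * m + i)%N = 0) ->
  runs cinit s (n.+1 * Tinit) (represents n m inp (Ast0 c n)).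
Proof.
move=> h0 h1 hi hz hc hr.
pose st j := State (upd (upd (nmem s) (n + m + 2) (j * m)) (n + m + 3) j)%N (rmem s).
have stN j : neval (st j) cN = (n + m)%N.
  by rewrite /= /upd !ifF; [rewrite h0 h1 | lia..].
have stC j : nmem (st j) (neval (st j) cCadr) = j.
  by rewrite neval_add stN /= /upd eqxx.
pose Inv k s1 := exists2 j, (j + k)%N = n &
  (forall a, nmem s1 a = nmem (st j) a) /\ rmem s1 = rmem s.
have nevalE s1 j e : (forall a, nmem s1 a = nmem (st j) a) ->
    neval s1 e = neval (st j) e.
  by move=> E; elim: e => //= [e ->|e1 -> e2 ->|e1 -> e2 ->|e1 -> e2 ->|e1 -> e2 ->].
have guard s1 j : (forall a, nmem s1 a = nmem (st j) a) ->
    beval s1 (BNLe (NAdd (NLoad cCadr) (NConst 1)) (NLoad (NConst 0)))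
    = (j < n)%N.
  move=> E; rewrite -[LHS]/(neval s1 _ <= neval s1 _)%N !(nevalE _ _ _ E).
  rewrite neval_add neval_load stC addn1 /= /upd !ifF; [by rewrite h0 | lia..].
have [||s' [t [e lt [k [j jk [E1 E2]]]]]] := @runs_while R
    (BNLe (NAdd (NLoad cCadr) (NConst 1)) (NLoad (NConst 0)))
    (Seq (NStore cMadr (NAdd cM (NLoad (NConst 1)))) cincr) s
    ((ntime cMadr + ntime (NAdd cM (NLoad (NConst 1)))).+1 + tincr) n Inv.
- move=> k s1 [j jk [E1 E2]]; rewrite (guard _ _ E1) => lj.
  eexists _, _; split; [|exact: leqnn|].
    by apply: ExecSeq; exact: ExecNStore.
  exists k.-1; first by lia.
  exists j.+1; first by lia.
  split=> // a.
  pose s2 := State (upd (nmem s1) (neval s1 cMadr)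
    (neval s1 (NAdd cM (NLoad (NConst 1))))) (rmem s1).
  rewrite -[LHS]/(upd (nmem s2) (neval s2 cCadr)
    (neval s2 (NAdd (NLoad cCadr) (NConst 1))) a).
  have Ea2 : neval s1 cMadr = (n + m + 2)%N.
    by rewrite (nevalE _ _ _ E1) neval_add stN.
  have Ev2 : neval s1 (NAdd cM (NLoad (NConst 1))) = (j * m + m)%N.
    rewrite (nevalE _ _ _ E1) neval_add 2!neval_load neval_add stN /= /upd.
    rewrite eqxx !ifF; [by rewrite h1 | lia..].
  have E3 a' : nmem s2 a' = nmem (State (upd (nmem (st j)) (n + m + 2)
      (j * m + m))%N (rmem s)) a'.
    rewrite -[LHS]/(upd (nmem s1) (neval s1 cMadr)
      (neval s1 (NAdd cM (NLoad (NConst 1)))) a').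
    by rewrite Ea2 Ev2 /upd E1.
  have s2N : neval s2 cN = (n + m)%N.
    rewrite -[LHS]/(nmem s2 0 + nmem s2 1)%N !E3 /= /upd.
    by rewrite !ifF; [rewrite h0 h1 | lia..].
  have s2C : neval s2 cCadr = (n + m + 3)%N by rewrite neval_add s2N.
  rewrite neval_add neval_load s2C /upd !E3 /= /upd.
  case: (a =P (n + m + 3)%N) => [_|_].
    by rewrite ifF ?eqxx ?addn1 //; lia.
  by case: eqP => // _; rewrite mulSn addnC.
- exists 0%N => //; split=> // a; rewrite /= /upd mul0n.
  case: eqP => [->|_]; first by rewrite hz //; lia.
  by case: eqP => [->|_] //; rewrite hz //; lia.
rewrite (guard _ _ E1) -leqNgt => lj.
have jn : j = n by lia.
rewrite {}jn {jk lj} in E1.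
exists s', t; split=> //; split.
- split; rewrite ?E1 /= /upd ?eqxx //.
  + by rewrite !ifF; [|lia..].
  + by rewrite !ifF; [|lia..].
  + by move=> v lv; rewrite E1 /= /upd !ifF; [exact: hi|lia..].
  + by rewrite ifF //; lia.
- by move=> k' i; rewrite E1 /= /upd !ifF; [apply: hz|..]; lia.
- by move=> e' le'; rewrite E2 hc.
- by move=> i; rewrite E2 hr.
Qed.

Lemma prep_spec c k (A' := prun prep (Ast0 c k)) :
  [/\ nv A' ASc 0 = 1%N, nv A' ASc 1 = (\sum_(v < n + m) inp v)%N,
      forall k, code k != code ASc -> nv A' k = (fun _ => 0%N)
    & cv A' = c /\ rv A' = (fun _ => 0)].
Proof.
pose Inv j A1 := [/\ nv A1 ASc 0 = 1%N, nv A1 ASc 1 = (\sum_(v < j) inp v)%N,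
      forall k, code k != code ASc -> nv A1 k = (fun _ => 0%N)
    & cv A1 = c /\ rv A1 = (fun _ => 0)].
apply: (@for_ind R n m inp Inv Nodes) => [|j A1 lj cj [p1 f1 z1 [c1 r1]]].
  by split=> //= [|k']; [rewrite big_ord0 | case: k'].
split=> //=.
- by rewrite /upd eqxx cj f1 big_ord_recr /= modn_small.
- by move=> k' nk; rewrite (negbTE nk) z1.
Qed.

Lemma write_out_spec A (A' := prun write_out A) :
  forall e, (e < n * m)%N -> cv A' e = (nv A AX e)%:R.
Proof.
pose Inv j A1 := nv A1 AX = nv A AX /\
  forall e, (e < j)%N -> cv A1 e = (nv A AX e)%:R.
suff [_] : Inv (n * m)%N A' by [].
apply: (@for_ind R n m inp Inv Edges) => [|j A1 lj cj [x1 H]] //.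
split=> //= e; rewrite ltnS cj x1 modn_small // /upd; case: eqP => [->//|ne le].
by apply: H; lia.
Qed.

(** All truncated margins are 0, so the zero flow fits; nonnegative costs make the zero potentials
    dual feasible, and the forest is empty. *)
Lemma main_inv_start c A K :
  nv A ASc 0 = (2 ^ K)%N -> (\sum_(v < n + m) inp v < 2 ^ K)%N ->
  (forall k, code k != code ASc -> nv A k = (fun _ => 0%N)) ->
  cv A = c -> rv A = (fun _ => 0) -> (forall e, 0 <= c e) ->
  main_inv n m inp c A.
Proof.
move=> PE lK z1 cE rE c0.
split=> //; right; exists K, (fun e => 0 < nv A AX e)%N.
have opt : optimal n m c (fun v => inp v %/ 2 ^ K)%N (nv A AX) (nv A AEx)
    (pot A) (fun _ => false).
  split=> //.
  - move=> v lv; rewrite z1 // z1 // /flow big1 // divn_small //.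
    apply: leq_ltn_trans lK; rewrite (bigD1 (Ordinal lv)) //=; exact: leq_addr.
  - by move=> e le; rewrite /pot rE addr0.
  - by move=> e le; rewrite z1.
  - by move=> z zF zf e le; apply: zF.
have [|S sd] := search_start (nv A APa) opt (mk := nv A AMk).
  by move=> v lv; rewrite !z1 // andbF.
by [].
Qed.

Lemma transport_runs (c : nat -> R) s B L :
  nmem s 0 = n -> nmem s 1 = m ->
  (forall v, (v < n + m)%N -> nmem s (2 + v)%N = inp v) ->
  (forall a, (n + m + 2 <= a)%N -> nmem s a = 0%N) ->
  (forall e, (e < n * m)%N -> rmem s e = c e) ->
  (forall i, rmem s (n * m + n * m + i)%N = 0) ->
  (forall e, 0 <= c e) ->
  (\sum_(i < n) inp i = \sum_(j < m) inp (n + j))%N ->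
  (\sum_(v < n + m) inp v < 2 ^ B)%N -> (B < L)%N ->
  (n + m + 2 <= L)%N -> (n * m < L)%N ->
  runs transport_alg s
    ((btime (BNLe (NConst 1) (NLoad (NConst 0)))
      + maxn (n.+1 * Tinit + (pconst prep * L +
      (B.+1 * (btime (cb (NLe (Scl 0) (Scl 1))) + pconst scale * L).+1
      + ((B.+1 * ((n + m).+1 * (n + m).+2) + (n + m)).+1
         * (btime (cb (Pos (Scl 0))) + pconst body * L).+1
         + pconst write_out * L)))) 0).+1)
    (fun s' => exists x p, full n m inp c x p /\
       forall e, (e < n * m)%N -> rmem s' e = (x e)%:R).
Proof.
move=> h0 h1 hi hz hc hr c0 sE lB BL lN2 lM.
have lN : (n + m < L)%N by lia.
apply: runs_if; rewrite ifT; last by rewrite /= h0.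
apply: runs_seq; first exact: init_spec h0 h1 hi hz hc hr.
move=> s0 r0; apply: (runs_seq (runs_cp n_gt0 m_gt0 prep r0 lN lM)).
move=> s1 r1; have [P1 F1 z1 [c1 rv1]] := prep_spec c n.
set A1 := prun prep _ in r1 P1 F1 z1 c1 rv1.
pose Inv A := [/\ exists2 k, (k <= B)%N & nv A ASc 0 = (2 ^ k)%N,
   nv A ASc 1 = (\sum_(v < n + m) inp v)%N,
   forall k, code k != code ASc -> nv A k = (fun _ => 0%N)
   & cv A = c /\ rv A = (fun _ => 0)].
pose mu A := (B - trunc_log 2 (nv A ASc 0))%N.
have IA1 : Inv A1 by split=> //; exists 0%N.
apply: (@runs_seq _ _ _ _ _ _ (fun s' => exists A, [/\ represents n m inp A s', Inv A &
    ~~ abeval A (NLe (Scl 0) (Scl 1))])).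
  have -> : B = mu A1 by rewrite /mu P1 trunc_log1 subn0.
  apply: runs_cwhile IA1 r1 => // A [[k lk PE] FE zE [cE rE]] g.
  have {}g : (2 ^ k <= \sum_(v < n + m) inp v)%N by rewrite -FE -PE.
  have lkB : (k < B)%N by rewrite -(@ltn_exp2l 2) // (leq_ltn_trans g).
  split; last by rewrite /mu /= /upd /= PE addnn -mul2n -expnS !trunc_expnK //; lia.
  split=> //.
    by exists k.+1 => //=; rewrite /upd /= PE addnn -mul2n -expnS.
  by move=> k' nk /=; rewrite (negbTE nk) zE.
move=> s2 [A2 [r2 [[k lk PE] FE zE [cE rE]] g]].
have {}g : (\sum_(v < n + m) inp v < 2 ^ k)%N by rewrite ltnNge -FE -PE.
have I2 := main_inv_start PE g zE cE rE c0.
have step A : main_inv n m inp c A -> abeval A (Pos (Scl 0)) ->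
    main_inv n m inp c (prun body A) /\
    (main_mu n m (prun body A) < main_mu n m A)%N by exact: body_spec.
have [s3 [t3 [e3 lt3 [A3 [r3 [c3 I3] g3]]]]] :=
  runs_cwhile n_gt0 m_gt0 lN lM step I2 r2.
(* Nothing waits to be sent before the first halving, so only the phases and the unmarked nodes
   count. *)
have mu2 : (main_mu n m A2 <= B.+1 * ((n + m).+1 * (n + m).+2) + (n + m))%N.
  rewrite /main_mu (zE AEx) // /excess big1 // min0n mul0n addn0 PE phases_exp.
  by apply: leq_add; [rewrite leq_mul2r ltnS lk orbT | exact: unmarked_le].
apply: (@runs_seq _ _ _ _ _ _ (fun s' => represents n m inp A3 s')).
  exists s3, t3; split=> //; apply: leq_trans lt3 _.
  by rewrite leq_mul2r ltnS mu2 orbT.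
have {I3} fA3 : full n m inp c (nv A3 AX) (pot A3).
  case: I3 => [[_ //]|[K [F [P3 _ _]]]].
  by case/negP: g3; rewrite -[X in is_true X]/(0 < nv A3 ASc 0)%N P3 expn_gt0.
move=> s4 r4.
have [s5 [t5 [e5 lt5 r5]]] := runs_cp n_gt0 m_gt0 write_out r4 lN lM.
exists s5, t5; split=> //; exists (nv A3 AX), (pot A3); split=> // e le.
by case: r5 => _ _ -> // _; rewrite write_out_spec.
Qed.

End Correctness.

(** * Instances *)

Lemma nth_allpairs (S T U : Type) (f : S -> T -> U) s t x0 s0 t0 i j :
  (i < size s)%N -> (j < size t)%N ->
  nth x0 [seq f a b | a <- s, b <- t] (i * size t + j)%N
  = f (nth s0 s i) (nth t0 t j).
Proof.
move=> + lj; elim: s i => // a s IH [_|i li].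
  by rewrite /= nth_cat size_map /= mul0n lj (nth_map t0).
rewrite /= nth_cat size_map mulSn -addnA ltnNge leq_addr /= addKn.
exact: IH.
Qed.

Section Instance.
Variables (R : realType) (I : fct R).

Local Notation n := (nsrc I).
Local Notation m := (nsnk I).

Definition inst_inp v : nat :=
  nth 0%N (codom (@supply R I) ++ codom (@demand R I)) v.
Definition inst_cost e : R := nth 0 (real_input I) e.

Lemma inst_inp_supply (i : 'I_n) : inst_inp i = supply i.
Proof.
rewrite /inst_inp nth_cat size_codom card_ord ltn_ord.
by rewrite (nth_map i) ?size_enum_ord // nth_ord_enum.
Qed.

Lemma inst_inp_demand (j : 'I_m) : inst_inp (n + j) = demand j.
Proof.
rewrite /inst_inp nth_cat size_codom card_ord ltnNge leq_addr addKn /=.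
by rewrite (nth_map j) ?size_enum_ord // nth_ord_enum.
Qed.

Lemma inst_costE (i : 'I_n) (j : 'I_m) : inst_cost (i * m + j) = cost_ratio i j.
Proof.
rewrite /inst_cost nth_cat size_allpairs !size_enum_ord edge_lt //.
have := @nth_allpairs _ _ _ (@cost_ratio R I) (enum 'I_n) (enum 'I_m) 0 i j i j.
by rewrite !size_enum_ord !nth_ord_enum => ->.
Qed.

Lemma size_real_input : size (real_input I) = (n * m + n * m)%N.
Proof. by rewrite size_cat !size_allpairs !size_enum_ord. Qed.

(** Beyond the linear costs [inst_cost] runs through the fixed costs, which are 1, and then the
    default 0. *)
Lemma inst_cost_ge0 e : (forall i j, @fixed_cost R I i j = 1) -> 0 <= inst_cost e.
Proof.
move=> f1; case: (ltnP e (size (real_input I))) => le; last first.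
  by rewrite /inst_cost nth_default.
have : inst_cost e \in real_input I by exact: mem_nth.
rewrite mem_cat => /orP[] /allpairsP[[i j] [_ _ ->]] /=.
  exact: cost_ratio_ge0.
by rewrite f1.
Qed.

Lemma inst_balanced :
  (\sum_(i < n) inst_inp i = \sum_(j < m) inst_inp (n + j))%N.
Proof.
under eq_bigr do rewrite inst_inp_supply.
under [RHS]eq_bigr do rewrite inst_inp_demand.
exact: balanced.
Qed.

Lemma inst_nsrc_nsnk : (n == 0%N) = (m == 0%N).
Proof.
have pos k (f : 'I_k -> nat) : (forall i, 0 < f i)%N ->
    (k == 0%N) = (\sum_i f i == 0)%N.
  move=> f0; case: k f f0 => [|k] f f0; first by rewrite big_ord0.
  by rewrite big_ord_recl; have := f0 ord0; lia.
by rewrite (pos _ _ (@supply_gt0 R I)) (pos _ _ (@demand_gt0 R I)) balanced.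
Qed.

Lemma feasible_rflow (y : 'M[R]_(n, m)) (z : nat -> R) :
  feasible I y -> (forall i j, z (val i * m + val j)%N = y i j) ->
  forall v, (v < n + m)%N -> rflow n m z v = (inst_inp v)%:R.
Proof.
move=> [_ yr yc] zE v lv; case: (ltnP v n) => lvn.
  rewrite rflow_src // (_ : v = Ordinal lvn) // inst_inp_supply -yr.
  by apply: eq_bigr => j _; rewrite zE.
have lvm : (v - n < m)%N by lia.
rewrite (_ : v = n + Ordinal lvm)%N /=; last by lia.
rewrite -[(v - n)%N]/(val (Ordinal lvm)) inst_inp_demand rflow_snk // -yc.
by apply: eq_bigr => i _; rewrite -zE.
Qed.

(** * Comparison with the optimum *)

Hypothesis unif : uniform_fixed_costs I.

Lemma cost_uniform (y : 'M[R]_(n, m)) :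
  cost y = \sum_i \sum_j (if 0 < y i j then 1 else 0)
         + \sum_i \sum_j cost_ratio i j * y i j.
Proof.
rewrite /cost -big_split; apply: eq_bigr => i _.
by rewrite -big_split; apply: eq_bigr => j _; rewrite unif.
Qed.

Lemma pos_term (k : nat) (f : 'I_k -> R) : 0 < \sum_i f i ->
  1 <= \sum_i (if 0 < f i then 1 else 0) :> R.
Proof.
move=> s0; have [i fi] : exists i, 0 < f i.
  apply/existsP; apply: contraTT s0; rewrite negb_exists => /forallP f0.
  by rewrite -leNgt sumr_le0 // => i _; rewrite leNgt.
rewrite (bigD1 i) //= fi lerDl sumr_ge0 // => j _; by case: ifP.
Qed.

(** Positive margins force an edge in every row and in every column. Adding both counts, instead of
    taking their maximum, is where the factor 2 comes from. *)
Lemma support_ge (y : 'M[R]_(n, m)) : feasible I y ->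
  (n + m)%:R <= 2 * \sum_i \sum_j (if 0 < y i j then 1 else 0) :> R.
Proof.
move=> [_ yr yc].
have l1 : n%:R <= \sum_i \sum_j (if 0 < y i j then 1 else 0) :> R.
  have {1}-> : n%:R = \sum_(i < n) 1 :> R by rewrite sumr_const card_ord.
  by apply: ler_sum => i _; apply: pos_term; rewrite yr ltr0n supply_gt0.
have l2 : m%:R <= \sum_i \sum_j (if 0 < y i j then 1 else 0) :> R.
  have {1}-> : m%:R = \sum_(i < m) 1 :> R by rewrite sumr_const card_ord.
  rewrite exchange_big /=.
  by apply: ler_sum => i _; apply: pos_term; rewrite yc ltr0n demand_gt0.
by rewrite natrD; lra.
Qed.

Lemma full_output x p s :
  full n m inst_inp inst_cost x p ->
  (forall e, (e < n * m)%N -> rmem s e = (x e)%:R) ->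
  feasible I (output I s) /\ cost (output I s) <= 2 * opt_cost I.
Proof.
move=> [ex [F [[bal le eq sup fF] xf]]] sE.
have oE i j : output I s i j = (x (i * m + j)%N)%:R.
  by rewrite mxE sE // edge_lt.
have feas : feasible I (output I s).
  split=> [i j|i|j]; first by rewrite oE.
    rewrite -inst_inp_supply -xf ?ltn_addr // -rflow_nat rflow_src //.
    by apply: eq_bigr => j _; rewrite oE.
  rewrite -inst_inp_demand -xf ?ltn_add2l // -rflow_nat rflow_snk //.
  by apply: eq_bigr => i _; rewrite oE.
split=> //.
have supp : \sum_i \sum_j (if 0 < output I s i j then 1 else 0)
    <= (n + m)%:R :> R.
  have <- : \sum_(e < n * m) (if (0 < x e)%N then 1 else 0) =
      \sum_i \sum_j (if 0 < output I s i j then 1 else 0) :> R.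
    rewrite (sum_edges n m _ (fun e => if (0 < x e)%N then 1 else 0)).
    by apply: eq_bigr => i _; apply: eq_bigr => j _; rewrite oE ltr0n.
  rewrite -big_mkcond /= sumr_const ler_nat.
  apply: (@forest_card R n m (fun e => (0 < x e)%N)).
  by apply: forest_sub fF => e l1 xe; apply: sup.
(* Complementary slackness: the linear cost of the output equals the dual value. *)
have cx : \sum_i \sum_j cost_ratio i j * output I s i j =
    \sum_(v < n + m) p v * (inst_inp v)%:R.
  have <- : \sum_(e < n * m) inst_cost e * (x e)%:R =
      \sum_i \sum_j cost_ratio i j * output I s i j.
    rewrite (sum_edges n m _ (fun e => inst_cost e * (x e)%:R)).
    by apply: eq_bigr => i _; apply: eq_bigr => j _; rewrite oE inst_costE.
  under [RHS]eq_bigr do rewrite -xf // -rflow_nat.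
  rewrite rflow_weight; apply: eq_bigr => e _.
  case: (posnP (x e)) => [->|xe]; first by rewrite mulr0 mul0r.
  by rewrite eq ?sup // mulrC.
have lower y : feasible I y ->
    cost (output I s) <= 2 * cost y.
  move=> yf; have := support_ge yf; rewrite !cost_uniform cx.
  have [y0 _ _] := yf.
  pose z e : R := if insub (e %/ m)%N is Some i
    then if insub (e %% m)%N is Some j then y i j else 0 else 0.
  have zE i j : z (val i * m + val j)%N = y i j.
    rewrite /z -[(_ %/ m)%N]/(src m _) srcE; last exact: ltn_ord.
    by rewrite modnMDl modn_small ?valK //; exact: ltn_ord.
  (* Weak duality for an arbitrary feasible [y]. *)
  have cy : \sum_(v < n + m) p v * (inst_inp v)%:R
      <= \sum_i \sum_j cost_ratio i j * y i j.
    have <- : \sum_(e < n * m) inst_cost e * z e =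
        \sum_i \sum_j cost_ratio i j * y i j.
      rewrite (sum_edges n m _ (fun e => inst_cost e * z e)).
      by apply: eq_bigr => i _; apply: eq_bigr => j _; rewrite zE inst_costE.
    under eq_bigr do rewrite -(feasible_rflow yf zE) //.
    rewrite rflow_weight; apply: ler_sum => e _; rewrite mulrC ler_wpM2r ?le //.
    by rewrite /z; do 2 case: insub => // ?.
  have cy0 : 0 <= \sum_i \sum_j cost_ratio i j * y i j.
    apply: sumr_ge0 => i _; apply: sumr_ge0 => j _; apply: mulr_ge0 => //.
    exact: cost_ratio_ge0.
  by move: supp cy cy0; lra.
(* An infimum is bounded below only over a nonempty set; the output itself is the witness. *)
suff : cost (output I s) / 2 <= opt_cost I by lra.
apply: lb_le_inf.
  by exists (cost (output I s)), (output I s).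
by move=> _ [y yf <-]; have := lower y yf; lra.
Qed.

(** * Input size and running time *)

Definition inst_bits : nat :=
  (\sum_(k <- codom (@supply R I) ++ codom (@demand R I)) bit_length k)%N.

Lemma input_sizeE : input_size I =
  (n * m + n * m + (bit_length n + (bit_length m + inst_bits)))%N.
Proof. by rewrite /input_size size_real_input /nat_input !big_cons. Qed.

Lemma size_inst_inp :
  size (codom (@supply R I) ++ codom (@demand R I)) = (n + m)%N.
Proof. by rewrite size_cat !size_codom !card_ord. Qed.

Lemma size_inst_bits : (n + m <= inst_bits)%N.
Proof. by rewrite -size_inst_inp -sum1_size; apply: leq_sum. Qed.

(** By induction, since a < x and S < y give a + S < (a + 1) * (S + 1) <= x * y, up to equality when
    a or S is 0. *)
Lemma inst_inp_lt : (\sum_(v < n + m) inst_inp v < 2 ^ inst_bits)%N.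
Proof.
have -> : (\sum_(v < n + m) inst_inp v =
    \sum_(k <- codom (@supply R I) ++ codom (@demand R I)) k)%N.
  by rewrite (big_nth 0%N) size_inst_inp big_mkord.
rewrite /inst_bits; elim: (_ ++ _) => [|a s IH]; first by rewrite !big_nil.
rewrite !big_cons expnD.
have : (a < 2 ^ bit_length a)%N by exact: trunc_log_ltn.
by move: IH; set S := bigop.body _ _ _; nia.
Qed.

End Instance.

Definition transport_const : nat :=
  (btime (BNLe (NConst 1) (NLoad (NConst 0))) + 2 + Tinit + pconst prep
   + (btime (cb (NLe (Scl 0) (Scl 1))) + pconst scale + 1)
   + 2 * (btime (cb (Pos (Scl 0))) + pconst body + 1) + pconst write_out)%N.

(** The fourth power: there are about B * (n + m)^2 rounds of the main loop, and each takes time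
    linear in L. *)
Lemma transport_time b0 Ti Kp b1 K1 b2 K2 K3 n m B L :
  (B < L -> n + m + 2 <= L ->
  (b0 + maxn (n.+1 * Ti + (Kp * L + (B.+1 * (b1 + K1 * L).+1
     + ((B.+1 * ((n + m).+1 * (n + m).+2) + (n + m)).+1 * (b2 + K2 * L).+1
        + K3 * L)))) 0).+1
  <= (b0 + 2 + Ti + Kp + (b1 + K1 + 1) + 2 * (b2 + K2 + 1) + K3) * L ^ 4)%N.
Proof.
move=> lB lN; have L0 : (0 < L)%N by lia.
rewrite maxn0.
have pw k : (k <= 4)%N -> (L ^ k <= L ^ 4)%N by move=> lk; rewrite leq_pexp2l.
have q0 : (1 <= L ^ 4)%N by rewrite expn_gt0 L0.
have q1 : (L <= L ^ 4)%N by rewrite -{1}(expn1 L) pw.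
have q2 : (L * L <= L ^ 4)%N by rewrite mulnn pw.
have aff b K : ((b + K * L).+1 <= (b + K + 1) * L)%N by nia.
have t1 : (n.+1 * Ti <= Ti * L ^ 4)%N.
  by rewrite mulnC leq_mul2l (leq_trans _ q1) ?orbT //; lia.
have t2 K : (K * L <= K * L ^ 4)%N by rewrite leq_mul2l q1 orbT.
have t3 : (B.+1 * (b1 + K1 * L).+1 <= (b1 + K1 + 1) * L ^ 4)%N.
  rewrite (leq_trans (leq_mul lB (aff b1 K1))) // mulnCA leq_mul2l q2 orbT //.
have t4 : ((B.+1 * ((n + m).+1 * (n + m).+2) + (n + m)).+1 * (b2 + K2 * L).+1
    <= 2 * (b2 + K2 + 1) * L ^ 4)%N.
  have l3 : ((B.+1 * ((n + m).+1 * (n + m).+2) + (n + m)).+1 <= 2 * L ^ 3)%N.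
    have l1 : (B.+1 * ((n + m).+1 * (n + m).+2) <= L ^ 3)%N.
      by rewrite !expnS expn0 muln1 !leq_mul //; lia.
    have : (L <= L ^ 3)%N by rewrite -{1}(expn1 L) leq_pexp2l.
    by lia.
  rewrite (leq_trans (leq_mul l3 (aff b2 K2))) // [(L ^ 4)%N]expnSr.
  by rewrite mulnACA.
move: t1 t3 t4 q0 (t2 Kp) (t2 K3) => {pw q1 q2 t2 aff}.
move: (n.+1 * _)%N (B.+1 * (b1 + _).+1)%N (_.+1 * (b2 + _).+1)%N (Kp * L)%N (K3 * L)%N.
move: (L ^ 4)%N => q X1 X2 X3 X4 X5; nia.
Qed.

Theorem theorem1p2 (R : realType) :
  exists alg : cmd,
    poly_time_approx_algorithm 2 (@uniform_fixed_costs R) alg.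
Proof.
exists transport_alg, (transport_const%:P * 'X^4) => I unif.
have pE : (transport_const%:P * 'X^4).[input_size I]
    = (transport_const * input_size I ^ 4)%N.
  by rewrite hornerCM hornerXn.
have LE := input_sizeE I; have lbits := size_inst_bits I.
have bl k : (0 < bit_length k)%N by [].
have lB : (inst_bits I < input_size I)%N.
  by have := bl (nsrc I); have := bl (nsnk I); lia.
have lN : (nsrc I + nsnk I + 2 <= input_size I)%N.
  by have := bl (nsrc I); have := bl (nsnk I); lia.
(* Without sources there are no sinks either; the program skips, and the empty matrix is read from
   the untouched memory. *)
rewrite pE; case: (posnP (nsrc I)) => [n0|n_gt0].
  have m0 : nsnk I = 0%N by apply/eqP; rewrite -inst_nsrc_nsnk n0.
  have [||feas le2] :=
      @full_output R I unif (fun _ => 0%N) (fun _ => 0) (input_state I).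
  - exists (fun _ => 0%N), (fun _ => false).
    by split=> [|v]; [split=> [v|e|e|e|z _ _ e]|]; rewrite n0 ?m0.
  - by move=> e; rewrite n0.
  exists (input_state I), (btime (BNLe (NConst 1) (NLoad (NConst 0))) + 1).+1%N.
  split=> //; first by apply: ExecIf; rewrite /= n0; apply: ExecSkip.
  have q0 : (1 <= input_size I ^ 4)%N by rewrite expn_gt0; lia.
  by apply: leq_trans (leq_pmulr _ q0); rewrite /transport_const; lia.
have m_gt0 : (0 < nsnk I)%N by rewrite lt0n -inst_nsrc_nsnk -lt0n.
have [||||s [t [e lt [x [p [fx sE]]]]]] :=
  @transport_runs R _ _ (inst_inp I) n_gt0 m_gt0 (inst_cost I) (input_state I)
    (inst_bits I) (input_size I) erefl erefl (fun v _ => erefl) _ (fun e _ => erefl)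
    _ _ (inst_balanced I) (inst_inp_lt I) lB lN.
- move=> a la; apply: nth_default.
  by rewrite /= size_inst_inp; lia.
- move=> i; apply: nth_default.
  by rewrite size_real_input leq_addr.
- by move=> e; apply: inst_cost_ge0.
- by have := bl (nsrc I); lia.
have [feas le2] := full_output unif fx sE.
exists s, t; split=> //; apply: leq_trans lt _; exact: transport_time.
Qed.
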